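(* Let $X$ be a real or complex Banach space and let $\mu$ be the Lebesgue measure on $[0,1]$. If $f\in S(L^1([0,1],X))$ is such that $S_f$ is either weakly compact or norm compact, then $|f|$ is smooth in $L^1(\mu)$.
   Context: $L^1([0,1],X)$ is the Banach space of (equivalence classes of) $X$-valued Bochner integrable functions on $[0,1]$ with norm $\|f\|=\int_{[0,1]}\|f(t)\|\,d\mu(t)$; $L^1(\mu)$ is the scalar-valued space. For $f\in L^1([0,1],X)$, $|f|\in L^1(\mu)$ is the function $|f|(t)=\|f(t)\|$. For a Banach space $E$, $S(E)$ denotes its unit sphere, and for $e\in S(E)$ the state space is $S_e=\{e^*\in S(E^* ):e^*(e)=1\}\subseteq E^*$; $S_f$ is taken with $E=L^1([0,1],X)$. A point $e\in S(E)$ is smooth in $E$ if $S_e$ is a singleton. Weakly compact means compact in $\sigma(E^*,E^{**})$; norm compact means compact in the norm topology of $E^*$. *)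

(* Defs.v *)
From HB Require Import structures.
From mathcomp Require Import all_boot all_order all_algebra.
From mathcomp Require Import all_classical all_reals all_analysis.
From mathcomp Require Import measurable_realfun ring_quotient.
From mathcomp Require Import complex.

Set Implicit Arguments.
Unset Strict Implicit.
Unset Printing Implicit Defensive.

Import Order.TTheory GRing.Theory Num.Theory.
Import numFieldNormedType.Exports.

Local Open Scope classical_set_scope.
Local Open Scope ring_scope.

Variant scalar_kind := RealScalars | ComplexScalars.

Definition scalars (R : realType) (k : scalar_kind) : numFieldType :=
  match k with RealScalars => R | ComplexScalars => R[i] end.

(* In a normed module over K the norm is K-valued; [of_real] and [to_real]
   identify R with the real elements of K. *)
Definition of_real {R : realType} {k : scalar_kind} : R -> scalars R k :=
  match k return R -> scalars R k with
  | RealScalars => id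
  | ComplexScalars => fun x => (x%:C)%C
  end.

Definition to_real {R : realType} {k : scalar_kind} : scalars R k -> R :=
  match k return scalars R k -> R with
  | RealScalars => id
  | ComplexScalars => fun z => complex.Re z
  end.

Section scalars_theory.
Context {R : realType} {k : scalar_kind}.
Notation K := (scalars R k).
Implicit Types (x y : R) (a b : K).

Lemma of_realK : cancel (of_real : R -> K) to_real.
Proof. by case: k. Qed.

Lemma to_realK a : 0 <= a -> of_real (to_real a) = a.
Proof. by case: k a => //= a /ger0_real/RRe_real. Qed.

Lemma of_real0 : of_real 0 = 0 :> K. Proof. by case: k. Qed.

Lemma of_realD x y : of_real (x + y) = of_real x + of_real y :> K.
Proof. by case: k => //=; rewrite rmorphD. Qed.

Lemma of_realM x y : of_real (x * y) = of_real x * of_real y :> K.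
Proof. by case: k => //=; rewrite rmorphM. Qed.

Lemma le_of_real x y : (of_real x <= of_real y :> K) = (x <= y).
Proof. by case: k => //=; exact: lecR. Qed.

Lemma lt_of_real x y : (of_real x < of_real y :> K) = (x < y).
Proof. by case: k => //=; exact: ltcR. Qed.

Lemma le_to_real a b : a <= b -> to_real a <= to_real b.
Proof. by case: k a b => //= a b; rewrite lecE => /andP[]. Qed.

Lemma lt_to_real a b : a < b -> to_real a < to_real b.
Proof. by case: k a b => //= a b; rewrite ltcE => /andP[]. Qed.

Lemma to_real0 : to_real (0 : K) = 0. Proof. by case: k. Qed.

Lemma to_realD a b : to_real (a + b) = to_real a + to_real b.
Proof. by case: k a b => //= a b; rewrite raddfD. Qed.

Lemma to_realB a b : to_real (a - b) = to_real a - to_real b.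
Proof. by case: k a b => //= a b; rewrite raddfB. Qed.

Lemma to_realM a b : 0 <= a -> 0 <= b -> to_real (a * b) = to_real a * to_real b.
Proof.
by move=> a0 b0; rewrite -[in LHS](to_realK a0) -[in LHS](to_realK b0)
  -of_realM of_realK.
Qed.

Definition rnorm (V : normedModType K) (v : V) : R := to_real `|v|.

Section norm.
Context {V : normedModType K}.
Implicit Types (v w : V).

Lemma rnormE v : of_real (rnorm v) = `|v|.
Proof. exact: to_realK. Qed.

Lemma rnorm_ge0 v : 0 <= rnorm v.
Proof. by rewrite -[leLHS]to_real0; exact: le_to_real. Qed.

Lemma rnorm0 : rnorm (0 : V) = 0.
Proof. by rewrite /rnorm normr0 to_real0. Qed.

Lemma rnorm_eq0 v : rnorm v = 0 -> v = 0.
Proof. by move=> v0; apply/normr0_eq0; rewrite -rnormE v0 of_real0. Qed.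

Lemma ler_rnormD v w : rnorm (v + w) <= rnorm v + rnorm w.
Proof. by rewrite -to_realD; apply/le_to_real/ler_normD. Qed.

Lemma rnormZ a v : rnorm (a *: v) = to_real `|a| * rnorm v.
Proof. by rewrite /rnorm normrZ to_realM. Qed.

Lemma rnorm_lipschitz v w :
  `|rnorm v - rnorm w| <= rnorm (v - w).
Proof.
wlog : v w / rnorm w <= rnorm v => [H|].
  have [|/ltW] := leP (rnorm w) (rnorm v); first exact: H.
  by move=> /H; rewrite distrC /rnorm (distrC v).
move=> wv; rewrite ger0_norm ?subr_ge0// lerBlDr -[in leLHS](subrK w v).
exact: ler_rnormD.
Qed.

Lemma rnorm_continuous : continuous (@rnorm V).
Proof.
move=> v; apply/cvgrPdist_lt => e e0.
have e0' : 0 < of_real e :> K by rewrite -of_real0 lt_of_real.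
near=> w; apply: (le_lt_trans (rnorm_lipschitz _ _)).
rewrite -(@lt_of_real) rnormE.
near: w; exact: cvgr_dist_lt.
Unshelve. all: by end_near. Qed.

End norm.
End scalars_theory.

Section dual.
Context {R : realType} {k : scalar_kind}.
Notation K := (scalars R k).
Variable E : normedModType K.

Definition continuous_linear_form : {pred E -> K^o} :=
  fun f => `[< linear f /\ continuous f >].

Lemma continuous_linear_form_submod_closed :
  submod_closed continuous_linear_form.
Proof.
split=> [|a f g /asboolP[lf cf] /asboolP[lg cg]]; apply/asboolP; split.
- by move=> a x y; rewrite -[RHS]/(a *: 0 + 0 : K^o) scaler0 addr0.
- exact: cst_continuous.
- move=> b x y; rewrite !fctE lf lg !scalerDr !scalerA (mulrC a).
  by rewrite addrACA.
- by move=> x; apply: cvgD; [apply: cvgZr; exact: cf|exact: cg].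
Qed.

HB.instance Definition _ := GRing.isSubmodClosed.Build _ _
  continuous_linear_form continuous_linear_form_submod_closed.

Record dual := Dual {
  dual_fun :> E -> K^o;
  dual_funP : dual_fun \in continuous_linear_form }.

HB.instance Definition _ := [isSub for dual_fun].
HB.instance Definition _ := [Choice of dual by <:].
HB.instance Definition _ := [SubChoice_isSubLmodule of dual by <:].

Lemma dual_linear (phi : dual) : linear phi.
Proof. by have /asboolP[] := dual_funP phi. Qed.

HB.instance Definition _ (phi : dual) :=
  GRing.isLinear.Build K E K^o _ phi (dual_linear phi).

Lemma dual_continuous (phi : dual) : continuous phi.
Proof. by have /asboolP[] := dual_funP phi. Qed.

Definition dual_norm (phi : dual) : R :=
  sup [set rnorm (phi x) | x in [set x : E | `|x| <= 1]].

Lemma dual_bounded (phi : dual) :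
  has_sup [set rnorm (phi x) | x in [set x : E | `|x| <= 1]].
Proof.
split; first by exists (rnorm (phi 0)), 0 => //=; rewrite normr0.
have /linear_bounded_continuous/linear_boundedP/pinfty_ex_gt0 :=
  @dual_continuous phi.
move=> [M M0 phiM]; exists (to_real M) => _ [x /= x1 <-].
apply: le_to_real; apply: (le_trans (phiM x)).
by rewrite -[leRHS]mulr1 ler_wpM2l// ltW.
Qed.

Lemma dual_norm_ub (phi : dual) (x : E) :
  rnorm (phi x) <= dual_norm phi * rnorm x.
Proof.
have [->|x0] := eqVneq x 0; first by rewrite linear0 !rnorm0 mulr0.
have nx0 : 0 < rnorm x.
  by rewrite lt_neqAle rnorm_ge0 andbT eq_sym;
     apply: contra x0 => /eqP/rnorm_eq0/eqP.
rewrite -ler_pdivrMr//.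
have /= := sup_upper_bound (dual_bounded phi).
have inv : to_real `|(of_real (rnorm x))^-1 : K| = (rnorm x)^-1.
  rewrite -[RHS](@of_realK R k); congr to_real.
  rewrite ger0_norm ?invr_ge0 -?[leLHS]of_real0 ?le_of_real ?ltW//.
  apply: (@mulfI _ (of_real (rnorm x))).
    by rewrite -of_real0 gt_eqF// lt_of_real.
  rewrite -of_realM !mulfV ?gt_eqF// -?of_real0 ?lt_of_real//.
  by case: (k).
apply; exists ((of_real (rnorm x))^-1 *: x) => /=.
  rewrite normrZ -(rnormE x) -[X in X * _]to_realK// inv -of_realM mulVf ?gt_eqF//.
  by case: (k).
by rewrite linearZ/= rnormZ inv mulrC.
Qed.

Let norm (phi : dual) : K := of_real (dual_norm phi).

Lemma dual_norm_le (phi : dual) (M : R) :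
  (forall x : E, `|x| <= 1 -> rnorm (phi x) <= M) -> dual_norm phi <= M.
Proof.
move=> phiM; apply: ge_sup; first by case: (dual_bounded phi).
by move=> _ [x /= x1 <-]; exact: phiM.
Qed.

Lemma dual_norm_ub1 (phi : dual) (x : E) :
  `|x| <= 1 -> rnorm (phi x) <= dual_norm phi.
Proof. by move=> x1; apply: sup_upper_bound (dual_bounded phi) _ _; exists x. Qed.

Let ler_normD (phi psi : dual) : norm (phi + psi) <= norm phi + norm psi.
Proof.
rewrite /norm -of_realD le_of_real; apply: dual_norm_le => x x1.
by rewrite (le_trans (ler_rnormD _ _))// lerD// dual_norm_ub1.
Qed.

Let dual_normZ_le (a : K) (phi : dual) :
  dual_norm (a *: phi) <= to_real `|a| * dual_norm phi.
Proof.
apply: dual_norm_le => x x1; rewrite rnormZ.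
by rewrite ler_wpM2l ?dual_norm_ub1// -[leLHS](@to_real0 R k) le_to_real.
Qed.

Let normZ (a : K) (phi : dual) : norm (a *: phi) = `|a| * norm phi.
Proof.
rewrite /norm -[in RHS](@to_realK R k `|a|)// -of_realM; congr of_real.
apply/eqP; rewrite eq_le dual_normZ_le/=.
have [->|a0] := eqVneq a 0.
  rewrite normr0 to_real0 mul0r (le_trans (rnorm_ge0 ((0 *: phi) (0 : E))))//.
  by apply: dual_norm_ub1; rewrite normr0.
have a0' : 0 < to_real `|a| by rewrite -[ltLHS](@to_real0 R k) lt_to_real ?normr_gt0.
rewrite -ler_pdivlMl//.
have := dual_normZ_le a^-1 (a *: phi).
rewrite scalerA mulVf// scale1r => /le_trans; apply.
rewrite ler_wpM2r//.
  by rewrite (le_trans (rnorm_ge0 ((a *: phi) (0 : E))))//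
    dual_norm_ub1// normr0.
rewrite -(@ler_pM2l _ (to_real `|a|))// mulfV ?gt_eqF// -to_realM//.
by rewrite -normrM mulfV// normr1; case: (k).
Qed.

Let norm0_eq0 (phi : dual) : norm phi = 0 -> phi = 0.
Proof.
rewrite -of_real0 => /(congr1 to_real); rewrite !of_realK => phi0.
apply/val_inj/funext => x; apply: rnorm_eq0.
apply/eqP; rewrite eq_le rnorm_ge0 andbT.
by rewrite (le_trans (dual_norm_ub _ _))// phi0 mul0r.
Qed.

HB.instance Definition _ :=
  Lmodule_isNormed.Build K dual ler_normD normZ norm0_eq0.

Lemma dual_normE (phi : dual) : `|phi| = of_real (dual_norm phi).
Proof. by []. Qed.

End dual.

Section weak_topology.
Context {R : realType} {k : scalar_kind}.
Notation K := (scalars R k).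

(* The coarsest topology making every element of E^* continuous, that is
   sigma(E, E^* ); for E a dual space this is sigma(E^*, E^** ). *)
Definition weak_topology (E : normedModType K) : Type :=
  initial_topology (fun x : E => (fun phi => phi x) : {ptws dual E -> K^o}).

HB.instance Definition _ (E : normedModType K) :=
  Topological.on (weak_topology E).

Definition weakly_compact (E : normedModType K) (A : set E) :=
  compact (A : set (weak_topology E)).

Definition state_space (E : normedModType K) (e : E) : set (dual E) :=
  [set phi : dual E | `|phi| = 1 /\ phi e = 1].

Definition smooth (E : normedModType K) (e : E) :=
  `|e| = 1 /\ exists phi, state_space e = [set phi].

End weak_topology.

Section bochner.
Context d {T : measurableType d} {R : realType}.
Variables (mu : {measure set T -> \bar R}) (D : set T).

Definition simple_on (Y : Type) (s : T -> Y) :=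
  finite_set (s @` D) /\ forall y, measurable (D `&` s @^-1` [set y]).

Context {k : scalar_kind}.
Notation K := (scalars R k).

(* The limit is taken almost everywhere only (mu-measurability in the sense of
   Bochner); no separate separability condition is then needed. *)
Definition strongly_measurable (X : normedModType K) (f : T -> X) :=
  exists2 s : nat -> T -> X, (forall n, simple_on (s n)) &
    {ae mu, forall t, D t -> s n t @[n --> \oo] --> f t}.

(* mu D is assumed finite wherever this is used, so that simple functions are
   integrable over D. *)
Definition bochner_integrable (X : normedModType K) (f : T -> X) :=
  strongly_measurable f /\
  exists2 s : nat -> T -> X, (forall n, simple_on (s n)) &
    (\int[mu]_(t in D) (rnorm (f t - s n t))%:E)%E @[n --> \oo]
      --> 0%E.

Hypothesis muC : measure_is_complete mu.
Hypothesis mD : measurable D.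

Lemma simple_on_comp (Y Z : Type) (s : T -> Y) (g : Y -> Z) :
  simple_on s -> simple_on (g \o s).
Proof.
move=> [fs ms]; split; first by rewrite -image_comp; exact: finite_image.
move=> z; rewrite (_ : _ `&` _ =
    \bigcup_(y in (s @` D) `&` g @^-1` [set z]) (D `&` s @^-1` [set y])).
  apply: fin_bigcup_measurable => // ; exact: finite_setIl.
apply/seteqP; split => [t [Dt /= gt]|t [y [_ gy] [Dt /= sy]]].
  by exists (s t) => //; split => //; exists t.
by split => //=; rewrite sy.
Qed.

Lemma simple_on_pair (Y Z : Type) (s : T -> Y) (r : T -> Z) :
  simple_on s -> simple_on r -> simple_on (fun t => (s t, r t)).
Proof.
move=> [fs ms] [fr mr]; split.
  apply: (sub_finite_set _ (finite_setX fs fr)) => _ [t Dt <-].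
  by split; exists t.
move=> [y z]; rewrite (_ : _ `&` _ =
    (D `&` s @^-1` [set y]) `&` (D `&` r @^-1` [set z])).
  exact: measurableI.
by apply/seteqP; split => [t [Dt [] <- <-]|t [[Dt /= <-] [_ /= <-]]].
Qed.

Lemma simple_on_cst (Y : Type) (y : Y) : simple_on (cst y).
Proof.
split; first by apply: (sub_finite_set _ (finite_set1 y)) => _ [t _ <-].
move=> z; have [->|yz] := pselect (y = z).
  by rewrite (_ : _ @^-1` _ = setT) ?setIT//; apply/seteqP.
rewrite (_ : _ @^-1` _ = set0) ?setI0//.
by apply/seteqP; split.
Qed.

Lemma simple_on_measurable d' (Y : measurableType d') (s : T -> Y) :
  simple_on s -> measurable_fun D s.
Proof.
move=> [fs ms] _ B mB; rewrite (_ : _ `&` _ =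
    \bigcup_(y in (s @` D) `&` B) (D `&` s @^-1` [set y])).
  apply: fin_bigcup_measurable => //; exact: finite_setIl.
apply/seteqP; split => [t [Dt Bt]|t [y [_ By] [Dt /= sy]]].
  by exists (s t) => //; split => //; exists t.
by split => //=; rewrite sy.
Qed.

Section strongly_measurable.
Context {X : normedModType K}.
Implicit Types f g : T -> X.

Lemma simple_on_strongly_measurable f : simple_on f -> strongly_measurable f.
Proof.
by move=> sf; exists (cst f) => //; apply: aeW => t _ /=; exact: cvg_cst.
Qed.

Lemma strongly_measurableD f g : strongly_measurable f ->
  strongly_measurable g -> strongly_measurable (f \+ g).
Proof.
move=> [s ss sf] [r sr rg]; exists (fun n => s n \+ r n) => [n|].
  exact: (simple_on_comp (fun p => p.1 + p.2) (simple_on_pair (ss n) (sr n))).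
by apply: filterS2 sf rg => t sf rg Dt; apply: cvgD; [exact: sf|exact: rg].
Qed.

Lemma strongly_measurableZ (a : K) f : strongly_measurable f ->
  strongly_measurable (a \*: f).
Proof.
move=> [s ss sf]; exists (fun n => a \*: s n) => [n|].
  exact: (simple_on_comp (fun x => a *: x) (ss n)).
by apply: filterS sf => t sf Dt; apply: cvgZr; exact: sf.
Qed.

Lemma strongly_measurable_norm f : strongly_measurable f ->
  @strongly_measurable K^o (fun t => `|f t|).
Proof.
move=> [s ss sf]; exists (fun n t => `|s n t|) => [n|].
  exact: (simple_on_comp (fun x => `|x| : K^o) (ss n)).
by apply: filterS sf => t sf Dt; apply: cvg_norm; exact: sf.
Qed.

Lemma strongly_measurable_normr f : strongly_measurable f ->
  measurable_fun D (fun t => rnorm (f t)).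
Proof.
move=> [s ss [A [mA A0 DA]]].
rewrite -(setIT D) -(setvU A) setIUr; apply/measurable_funU.
- by apply: measurableI => //; exact: measurableC.
- exact: measurableI.
split; last first.
  move=> _ B mB; apply: muC; exists (D `&` A); split.
  - exact: measurableI.
  - by apply/eqP; rewrite eq_le measure_ge0 andbT -A0 le_measure ?inE//;
       exact: measurableI.
  - by move=> t [].
apply: (@measurable_fun_cvg _ _ _ _ (fun n t => rnorm (s n t))) => [n|t].
  apply: (measurable_funS mD (@subIsetl _ _ _)).
  exact: simple_on_measurable (simple_on_comp (@rnorm _ _ X) (ss n)).
move=> [Dt nAt].
have /(_ Dt) st : D t -> s n t @[n --> \oo] --> f t.
  by apply: contrapT => nst; apply: nAt; exact: DA.
exact: (continuous_cvg _ (@rnorm_continuous _ _ X (f t)) st).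
Qed.

End strongly_measurable.

Lemma strongly_measurableB (X : normedModType K) (f g : T -> X) :
  strongly_measurable f -> strongly_measurable g ->
  strongly_measurable (fun t => f t - g t).
Proof.
move=> sf sg; have := strongly_measurableD sf (strongly_measurableZ (-1) sg).
congr strongly_measurable; apply/funext => t /=.
by rewrite /GRing.scale_fun scaleN1r.
Qed.

Lemma strongly_measurable_rnorm (X : normedModType K) (f : T -> X) :
  strongly_measurable f -> measurable_fun D (fun t => (rnorm (f t))%:E).
Proof. by move=> /strongly_measurable_normr/measurable_EFinP. Qed.

Section bochner_integrable.
Context {X : normedModType K}.
Implicit Types f g : T -> X.

Lemma simple_on_bounded f : simple_on f ->
  exists2 M, 0 <= M & forall t, D t -> rnorm (f t) <= M.
Proof.
move=> [/finite_seqP[s fs] _]; have {fs} : forall t, D t -> f t \in s.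
  by move=> t Dt; have : [set` s] (f t) by rewrite -fs; exists t.
elim: s (f @` D) => [|x s IH] _ fs; first by exists 0 => // t /fs.
have [M M0 sM] : exists2 M, 0 <= M & forall y, y \in x :: s -> rnorm y <= M.
  elim: (x :: s) => [|z r [M M0 rM]]; first by exists 0.
  exists (Num.max (rnorm z) M) => [|y]; first by rewrite le_max M0 orbT.
  rewrite inE => /predU1P[->|/rM yM].
    by rewrite le_max lexx.
  by rewrite le_max yM orbT.
by exists M => // t /fs/sM.
Qed.

Lemma bochner_integrable_lty f : (mu D < +oo)%E -> bochner_integrable f ->
  (\int[mu]_(t in D) (rnorm (f t))%:E < +oo)%E.
Proof.
move=> muD [sf [s ss s0]].
have [n sn] : exists n,
    (\int[mu]_(t in D) (rnorm (f t - s n t))%:E < 1%:E)%E.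
  have [//|n _ /(_ n (leqnn n)) ?] := s0 [set y | (y < 1%:E)%E]; last by exists n.
  apply: open_nbhs_nbhs; split; first exact: open_ereal_lt_ereal.
  by rewrite /= lte_fin.
have sms := simple_on_strongly_measurable (ss n).
have [M M0 sM] := simple_on_bounded (ss n).
apply: (@le_lt_trans _ _
  (\int[mu]_(t in D) ((rnorm (f t - s n t))%:E + (rnorm (s n t))%:E))%E).
  apply: ge0_le_integral => //.
  - by move=> t _; rewrite lee_fin rnorm_ge0.
  - exact: strongly_measurable_rnorm.
  - by apply: emeasurable_funD; apply: strongly_measurable_rnorm => //;
       exact: strongly_measurableB.
  - by move=> t _; rewrite -EFinD lee_fin -[in leLHS](subrK (s n t) (f t))
      ler_rnormD.
rewrite ge0_integralD//; first last.
- exact: strongly_measurable_rnorm.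
- by move=> t _; rewrite lee_fin rnorm_ge0.
- by apply: strongly_measurable_rnorm; exact: strongly_measurableB.
- by move=> t _; rewrite lee_fin rnorm_ge0.
rewrite lte_add_pinfty//; first by rewrite (lt_trans sn)// ltry.
apply: (@le_lt_trans _ _ (\int[mu]_(t in D) M%:E)%E).
  apply: ge0_le_integral => //.
  - by move=> t _; rewrite lee_fin rnorm_ge0.
  - exact: strongly_measurable_rnorm.
by rewrite (integral_cst mu mD M%:E) lte_mul_pinfty.
Qed.


Lemma bochner_integrable0 : bochner_integrable (0 : T -> X).
Proof.
split; first exact/simple_on_strongly_measurable/simple_on_cst.
exists (fun=> 0) => [n|]; first exact: simple_on_cst.
rewrite (_ : (fun _ : nat => _) = cst 0%E); first exact: cvg_cst.
apply/funext => n; apply: integral0_eq => t _.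
by rewrite subrr rnorm0.
Qed.

Lemma bochner_integrable_lin (a : K) f g :
  bochner_integrable f -> bochner_integrable g ->
  bochner_integrable (a *: f + g).
Proof.
move=> [mf [s ss s0]] [mg [r sr r0]]; split.
  exact: (strongly_measurableD (strongly_measurableZ a mf) mg).
exists (fun n t => a *: s n t + r n t) => [n|].
  exact: (simple_on_comp (fun p => a *: p.1 + p.2) (simple_on_pair (ss n) (sr n))).
have a0 : 0 <= to_real `|a| by rewrite -[leLHS](@to_real0 R k) le_to_real.
apply: (@squeeze_cvge _ _ _ _ (cst 0%E) _
  (fun n => (to_real `|a|)%:E * \int[mu]_(t in D) (rnorm (f t - s n t))%:E +
            \int[mu]_(t in D) (rnorm (g t - r n t))%:E)%E).
- apply: nearW => n; apply/andP; split.
    by apply: integral_ge0 => t _; rewrite lee_fin rnorm_ge0.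
  have mfs : measurable_fun D (fun t => (rnorm (f t - s n t))%:E).
    apply/strongly_measurable_rnorm/strongly_measurableB => //.
    exact: simple_on_strongly_measurable.
  have mgr : measurable_fun D (fun t => (rnorm (g t - r n t))%:E).
    apply/strongly_measurable_rnorm/strongly_measurableB => //.
    exact: simple_on_strongly_measurable.
  rewrite -ge0_integralZl//; last by move=> t _; rewrite lee_fin rnorm_ge0.
  have mafs : measurable_fun D
      (fun t => (to_real `|a|)%:E * (rnorm (f t - s n t))%:E)%E.
    exact: measurable_funeM.
  rewrite -ge0_integralD//; first last.
  - by move=> t _; rewrite lee_fin rnorm_ge0.
  - by move=> t _; rewrite mule_ge0// lee_fin rnorm_ge0.
  apply: ge0_le_integral => //.
  - by move=> t _; rewrite lee_fin rnorm_ge0.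
  - apply/strongly_measurable_rnorm/strongly_measurableB.
      exact: (strongly_measurableD (strongly_measurableZ a mf) mg).
    apply/simple_on_strongly_measurable.
    exact: (simple_on_comp (fun p => a *: p.1 + p.2)
      (simple_on_pair (ss n) (sr n))).
  - exact: emeasurable_funD.
  - move=> t Dt; rewrite -EFinM -EFinD lee_fin -rnormZ.
    rewrite (_ : _ - _ = a *: (f t - s n t) + (g t - r n t)) ?ler_rnormD//.
    by rewrite scalerBr addrACA opprD.
- exact: cvg_cst.
- rewrite (_ : 0 = (to_real `|a|)%:E * 0 + 0)%E; last by rewrite mule0 adde0.
  by apply: cvgeD => //; apply: cvgeZl.
Qed.

Lemma bochner_integrable_norm f :
  bochner_integrable f -> @bochner_integrable K^o (fun t => `|f t|).
Proof.
move=> [mf [s ss s0]]; split; first exact: strongly_measurable_norm.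
exists (fun n t => `|s n t|) => [n|].
  exact: (simple_on_comp (fun x => `|x| : K^o) (ss n)).
have mnB n : measurable_fun D (fun t => (rnorm (f t - s n t))%:E).
  apply/strongly_measurable_rnorm/strongly_measurableB => //.
  exact: simple_on_strongly_measurable.
apply: (squeeze_cvge _ (cvg_cst 0%E) s0).
apply: nearW => n; apply/andP; split.
  by apply: integral_ge0 => t _; rewrite lee_fin rnorm_ge0.
apply: ge0_le_integral => //.
- by move=> t _; rewrite lee_fin rnorm_ge0.
- apply/strongly_measurable_rnorm/strongly_measurableB.
    exact: strongly_measurable_norm.
  apply/simple_on_strongly_measurable.
  exact: (simple_on_comp (fun x => `|x| : K^o) (ss n)).
- by move=> t Dt; rewrite lee_fin; apply/le_to_real/ler_dist_dist.
Qed.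

Definition bochner_norm f : R := fine (\int[mu]_(t in D) (rnorm (f t))%:E).

Lemma bochner_norm_ge0 f : 0 <= bochner_norm f.
Proof.
by apply/fine_ge0/integral_ge0 => t _; rewrite lee_fin rnorm_ge0.
Qed.

Hypothesis muD : (mu D < +oo)%E.

Lemma bochner_normE f : bochner_integrable f ->
  (bochner_norm f)%:E = (\int[mu]_(t in D) (rnorm (f t))%:E)%E.
Proof.
move=> bf; rewrite fineK// ge0_fin_numE; first exact: bochner_integrable_lty.
by apply/integral_ge0 => t _; rewrite lee_fin rnorm_ge0.
Qed.

Lemma ler_bochner_normD f g : bochner_integrable f -> bochner_integrable g ->
  bochner_norm (f + g) <= bochner_norm f + bochner_norm g.
Proof.
move=> bf bg.
have bfg : bochner_integrable (f + g).
  by have := bochner_integrable_lin 1 bf bg; rewrite scale1r.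
rewrite -lee_fin EFinD !bochner_normE// -ge0_integralD//.
- apply: ge0_le_integral => //.
  + by move=> t _; rewrite lee_fin rnorm_ge0.
  + exact: strongly_measurable_rnorm bfg.1.
  + by apply: emeasurable_funD; apply: strongly_measurable_rnorm;
      [exact: bf.1|exact: bg.1].
  + by move=> t _; rewrite -EFinD lee_fin ler_rnormD.
- by move=> t _; rewrite lee_fin rnorm_ge0.
- exact: strongly_measurable_rnorm bf.1.
- by move=> t _; rewrite lee_fin rnorm_ge0.
- exact: strongly_measurable_rnorm bg.1.
Qed.

Lemma bochner_normZ (a : K) f : bochner_integrable f ->
  bochner_norm (a *: f) = to_real `|a| * bochner_norm f.
Proof.
move=> bf; apply: EFin_inj; rewrite EFinM !bochner_normE//; last first.
  have := bochner_integrable_lin a bf bochner_integrable0.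
  by rewrite addr0.
rewrite -ge0_integralZl//.
- by apply: eq_integral => t _; rewrite -EFinM -rnormZ.
- exact: strongly_measurable_rnorm bf.1.
- by move=> t _; rewrite lee_fin rnorm_ge0.
- by rewrite lee_fin -[leLHS](@to_real0 R k) le_to_real.
Qed.

Lemma bochner_norm_eq0 f : bochner_integrable f ->
  bochner_norm f = 0 <-> {ae mu, forall t, D t -> f t = 0}.
Proof.
move=> bf; have := ae_eq_integral_abs mu mD (strongly_measurable_rnorm bf.1).
rewrite (eq_integral (fun t => (rnorm (f t))%:E)); last first.
  by move=> t _; rewrite /= ger0_norm ?rnorm_ge0.
rewrite -bochner_normE// => normP; split => [f0|f0].
  have /normP : (bochner_norm f)%:E = 0%E by rewrite f0.
  by apply: filterS => t /[apply] -[] /rnorm_eq0.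
suff /normP[] : ae_eq mu D (fun t => (rnorm (f t))%:E) (cst 0%E) by [].
by apply: filterS f0 => t /[apply] ->; rewrite rnorm0.
Qed.

End bochner_integrable.

End bochner.

(* Elements of L^1([0,1], X) are represented by functions defined on all of R;
   their values outside [0,1] are irrelevant, being ignored by integrability,
   by almost everywhere equality and by the norm. The sigma-algebra is that of
   Lebesgue measurable sets, so the measure is complete. *)
Section L1.
Context {R : realType} {k : scalar_kind}.
Notation K := (scalars R k).
Notation mu := (@completed_lebesgue_measure R).
Notation I := (`[0, 1]%classic : set R).

Let muC : measure_is_complete mu.
Proof. exact: completed_lebesgue_measure_is_complete. Qed.

Lemma measurable_unit_itv : ((@wlength R idfun)^*)%mu.-cara.-measurable I.
Proof. by apply: sub_caratheodory; exact: measurable_itv. Qed.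

Lemma completed_lebesgue_measure_unit_itv : mu I = 1%E.
Proof.
rewrite [LHS](_ : _ = @lebesgue_measure R I)// lebesgue_measure_itv/=.
by rewrite lte_fin ltr01 oppr0 adde0.
Qed.

Let mI := measurable_unit_itv.
Let muI : (mu I < +oo)%E.
Proof. by rewrite completed_lebesgue_measure_unit_itv ltry. Qed.

Let aeS := @filterS _ _ (ae_filter_ringOfSetsType mu).
Let aeS2 := @filterS2 _ _ (ae_filter_ringOfSetsType mu).

Variable X : normedModType K.

Definition bochner_pred : {pred R -> X} :=
  fun f => `[< bochner_integrable mu I f >].

Lemma bochner_submod_closed : submod_closed bochner_pred.
Proof.
split=> [|a f g /asboolP bf /asboolP bg]; apply/asboolP.
  exact: bochner_integrable0.
exact: bochner_integrable_lin.
Qed.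

HB.instance Definition _ := GRing.isSubmodClosed.Build _ _
  bochner_pred bochner_submod_closed.

Record bochner := Bochner {
  bochner_fun :> R -> X;
  bochner_funP : bochner_fun \in bochner_pred }.

HB.instance Definition _ := [isSub for bochner_fun].
HB.instance Definition _ := [Choice of bochner by <:].
HB.instance Definition _ := [SubChoice_isSubLmodule of bochner by <:].

Lemma bochnerP (f : bochner) : bochner_integrable mu I f.
Proof. exact/asboolP/bochner_funP. Qed.

Definition ae_zero : {pred bochner} :=
  fun f => `[< {ae mu, forall t, I t -> f t = 0} >].

Lemma ae_zeroP (f : bochner) : reflect (bochner_norm mu I f = 0) (f \in ae_zero).
Proof.
apply: (iffP idP) => [/asboolP|] /(bochner_norm_eq0 muC mI muI (bochnerP f)) //.
by move=> /asboolP.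
Qed.

Lemma ae_zero_submod_closed : submod_closed ae_zero.
Proof.
split=> [|a f g /asboolP f0 /asboolP g0]; apply/asboolP; first exact: aeW.
apply: aeS2 f0 g0 => t f0 g0 It.
suff : a *: f t + g t = 0 by [].
by rewrite (f0 It) (g0 It) scaler0 addr0.
Qed.

HB.instance Definition _ := GRing.isSubmodClosed.Build _ _
  ae_zero ae_zero_submod_closed.

Definition L1 : Type := Quotient.quot ae_zero.
HB.instance Definition _ := GRing.Zmodule.on L1.
HB.instance Definition _ := EqQuotient.on L1.

Local Open Scope quotient_scope.

Lemma L1_eqP (f g : bochner) :
  reflect {ae mu, forall t, I t -> f t = g t} (\pi_L1 f == \pi_L1 g).
Proof.
rewrite -Quotient.idealrBE.
apply: (iffP idP) => [/asboolP|] fg; [|apply/asboolP]; apply: aeS fg => t + It;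
  move=> /(_ It).
- by move=> fg; apply/eqP; rewrite -subr_eq0; apply/eqP; exact: fg.
- by move=> fg; suff : f t - g t = 0 by []; rewrite fg subrr.
Qed.

Lemma L1_piD (f g : bochner) : \pi_L1 (f + g) = \pi_L1 f + \pi_L1 g.
Proof. exact: Quotient.pi_add. Qed.

Definition L1_scale (a : K) (u : L1) : L1 := \pi_L1 (a *: repr u).

Lemma repr_L1 (f : bochner) :
  {ae mu, forall t, I t -> (repr (\pi_L1 f)) t = f t}.
Proof. by apply/L1_eqP; rewrite reprK. Qed.

Lemma L1_piZ (a : K) (f : bochner) : \pi_L1 (a *: f) = L1_scale a (\pi_L1 f).
Proof.
apply/eqP/L1_eqP; apply: aeS (repr_L1 f) => t ft It.
by rewrite [LHS]/(a *: f t) [RHS]/(a *: repr (\pi_L1 f) t) ft.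
Qed.

Let scaleA a b u : L1_scale a (L1_scale b u) = L1_scale (a * b) u.
Proof. by elim/quotW: u => f; rewrite -(L1_piZ b f) -!L1_piZ scalerA. Qed.

Let scale1 : left_id 1 L1_scale.
Proof. by elim/quotW=> f; rewrite -L1_piZ scale1r. Qed.

Let scaleDr : right_distributive L1_scale +%R.
Proof.
move=> a; elim/quotW=> f; elim/quotW=> g.
by rewrite -(L1_piD f g) -(L1_piZ a f) -(L1_piZ a g) -!L1_piZ -L1_piD scalerDr.
Qed.

Let scaleDl u : {morph L1_scale^~ u : a b / a + b}.
Proof.
by move=> a b; elim/quotW: u => f; rewrite -(L1_piZ a f) -(L1_piZ b f) -L1_piD -L1_piZ scalerDl.
Qed.

HB.instance Definition _ := GRing.Zmodule_isLmodule.Build K L1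
  scaleA scale1 scaleDr scaleDl.

Lemma L1_pi_scale (a : K) (f : bochner) : \pi_L1 (a *: f) = a *: \pi_L1 f.
Proof. exact: L1_piZ. Qed.

Definition L1_norm (u : L1) : K := of_real (bochner_norm mu I (repr u)).

Lemma L1_norm_pi (f : bochner) : L1_norm (\pi_L1 f) = of_real (bochner_norm mu I f).
Proof.
suff H (g h : bochner) : {ae mu, forall t, I t -> g t = h t} ->
    bochner_norm mu I g <= bochner_norm mu I h.
  congr of_real; apply/eqP; rewrite eq_le; apply/andP; split; apply: H.
    exact: repr_L1.
  by apply: aeS (repr_L1 f) => t /[apply] ->.
move=> gh; rewrite -[g](subrK h).
apply: (le_trans (ler_bochner_normD muC mI muI (bochnerP _) (bochnerP _))).
rewrite gerDr; have /ae_zeroP -> // : g - h \in ae_zero.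
by rewrite Quotient.idealrBE; exact/L1_eqP.
Qed.

Let ler_normD u v : L1_norm (u + v) <= L1_norm u + L1_norm v.
Proof.
elim/quotW: u => f; elim/quotW: v => g; rewrite -L1_piD !L1_norm_pi -of_realD le_of_real.
exact: ler_bochner_normD (bochnerP _) (bochnerP _).
Qed.

Let normZ a u : L1_norm (a *: u) = `|a| * L1_norm u.
Proof.
elim/quotW: u => f; rewrite -L1_pi_scale !L1_norm_pi.
rewrite (bochner_normZ muC mI muI a (bochnerP _)) of_realM.
by congr (_ * _); rewrite to_realK.
Qed.

Let norm0_eq0 u : L1_norm u = 0 -> u = 0.
Proof.
elim/quotW: u => f; rewrite L1_norm_pi -of_real0 => /(congr1 to_real).
rewrite !of_realK => /(bochner_norm_eq0 muC mI muI (bochnerP f)) f0.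
by transitivity (\pi_L1 (0 : bochner)); [exact/eqP/L1_eqP|exact: pi_zeror].
Qed.

HB.instance Definition _ := Lmodule_isNormed.Build K L1 ler_normD normZ norm0_eq0.

Lemma L1_normE (f : bochner) : `|\pi_L1 f| = of_real (bochner_norm mu I f).
Proof. exact: L1_norm_pi. Qed.

End L1.

Section absL1.
Context {R : realType} {k : scalar_kind}.
Notation K := (scalars R k).
Variable X : normedModType K.
Local Open Scope quotient_scope.

Lemma abs_bochner_subproof (f : bochner X) :
  (fun t => `|f t|) \in @bochner_pred R k K^o.
Proof.
apply/asboolP/bochner_integrable_norm/bochnerP.
- exact: completed_lebesgue_measure_is_complete.
- exact: measurable_unit_itv.
Qed.

Definition abs_bochner (f : bochner X) : bochner K^o :=
  Bochner (abs_bochner_subproof f).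

(* The class of |f|, with values in the field of scalars K. *)
Definition absL1 (u : L1 X) : L1 K^o := \pi_(L1 K^o) (abs_bochner (repr u)).

Lemma absL1_pi (f : bochner X) :
  absL1 (\pi_(L1 X) f) = \pi_(L1 K^o) (abs_bochner f).
Proof.
apply/eqP/L1_eqP; apply: (@filterS _ _ (ae_filter_ringOfSetsType _) _ _ _) (repr_L1 f) => t ft It.
by rewrite /= ft.
Qed.

End absL1.

(* Main.v *)
Require Import Defs.
From HB Require Import structures.
From mathcomp Require Import all_boot all_order all_algebra.
From mathcomp Require Import all_classical all_reals all_analysis.
From mathcomp Require Import measurable_realfun complex ring lra.

(* |f| fails to be smooth only if f vanishes on a set Z of positive measure:
   when f is almost everywhere nonzero, (|g + t h| + |g - t h| - 2 |g|) / t with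
   g = |f| is at most 2 |h| and tends to 0 almost everywhere with t, so by
   dominated convergence the norm of L^1 is Gateaux differentiable at |f|.

   If Z has positive measure, choose measurable sets Z > B_0 > B_1 > ...
   such that each D_j = B_j \ B_{j+1} has positive measure, and a unit vector x.
   By Hahn-Banach there is a norm-one functional psi_n attaining its norm at
   f + (1_{B_n} - 1_{Z \ B_n}) x; the norm being additive over disjoint supports,
   psi_n lies in S_f and takes at u_j = 1_{D_j} x / mu(D_j) the value 1 if n <= j
   and -1 if j < n. A weak cluster point psi of (psi_n) satisfies psi(u_j) = -1 for
   all j, so a weak-star cluster point Phi of (u_j) in the bidual has Phi(psi) = -1
   although Phi(psi_n) = 1 for every n. *)

Set Implicit Arguments.
Unset Strict Implicit.
Unset Printing Implicit Defensive.

Import Order.TTheory GRing.Theory Num.Theory.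
Import numFieldNormedType.Exports.
Local Open Scope classical_set_scope.
Local Open Scope ring_scope.

(** * Real parts of scalars *)

Section real_part.
Context {R : realType} {k : scalar_kind}.
Notation K := (scalars R k).
Implicit Types (r s : R) (a b : K).

Lemma of_real1 : of_real 1 = 1 :> K. Proof. by case: k. Qed.

Lemma of_realN r : of_real (- r) = - of_real r :> K.
Proof. by apply: (addrI (of_real r)); rewrite -of_realD !subrr of_real0. Qed.

Lemma to_realN a : to_real (- a) = - to_real a.
Proof. by rewrite -sub0r to_realB to_real0 sub0r. Qed.

Lemma to_real_scale r a : to_real (of_real r * a) = r * to_real a.
Proof. by case: k a => //= -[x y] /=; rewrite mul0r subr0. Qed.

Lemma rnorm_scale_real (V : normedModType K) r (v : V) :
  rnorm (of_real r *: v) = `|r| * rnorm v.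
Proof.
rewrite rnormZ; congr (_ * _); have [r0|/ltW r0] := leP 0 r.
  by rewrite !ger0_norm ?of_realK// -[leLHS](@of_real0 R k) le_of_real.
by rewrite !ler0_norm -?of_realN ?of_realK// -[leRHS](@of_real0 R k) le_of_real.
Qed.

Lemma rnormN (V : normedModType K) (v : V) : rnorm (- v) = rnorm v.
Proof. by rewrite /rnorm normrN. Qed.

Lemma ler_to_real_norm a : to_real a <= to_real `|a|.
Proof.
case: k a => /= [x|z]; first exact: ler_norm.
by have := normc_ge_Re z; rewrite lecE => /andP[_]; exact: le_trans (ler_norm _).
Qed.

(** Squaring the inequality between modulus and real part leaves no room for an imaginary part. This
    upgrades statements on real parts to equalities of scalars. *)
Lemma ger0_of_to_real a : to_real `|a| <= to_real a -> a = `|a|.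
Proof.
case: k a => /= [x|[x y]] /=; first by move=> /(le_trans (normr_ge0 x))/ger0_norm.
move=> h; have x0 : 0 <= x by rewrite (le_trans _ h)// sqrtr_ge0.
have : Num.sqrt (x ^+ 2 + y ^+ 2) ^+ 2 <= x ^+ 2.
  by rewrite ler_pXn2r// nnegrE sqrtr_ge0.
rewrite sqr_sqrtr ?addr_ge0 ?sqr_ge0// gerDl => y2.
have -> : y = 0 by apply/eqP; rewrite -sqrf_eq0 eq_le y2 sqr_ge0.
by rewrite normc_def /= expr0n addr0 sqrtr_sqr ger0_norm.
Qed.

(** Rotating by a scalar of modulus at most 1 turns bounds on the real part of a functional into
    bounds on its modulus. *)
Lemma rotate_norm a : exists2 b, `|b| <= 1 & b * a = `|a|.
Proof.
have [->|a0] := eqVneq a 0; first by exists 0; rewrite ?normr0 ?ler01// mul0r.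
exists (`|a| / a); last by rewrite divfK.
by rewrite normrM normfV normr_id divff ?normr_eq0.
Qed.

(** The law of cosines for a real and an arbitrary scalar, in one form for both fields. *)
Lemma sqr_to_real_norm r a : to_real `|of_real r + a| ^+ 2 =
  r ^+ 2 + 2 * r * to_real a + to_real `|a| ^+ 2.
Proof.
case: k a => /= [x|[x y]] /=; first by rewrite !real_normK ?num_real//; ring.
rewrite !sqr_sqrtr ?addr_ge0 ?sqr_ge0//; ring.
Qed.

End real_part.

(** * The Hahn-Banach theorem *)

Section sublinear.
Context {R : realType} {k : scalar_kind}.
Notation K := (scalars R k).
Context {V : lmodType K}.
Implicit Types (r s t : R) (x y : V) (p q : V -> R).

(** Real scalars act through [of_real], so [V] is handled as a real vector space and a single Zorn
    argument covers both fields. *)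
Definition sublinear p := (forall x y, p (x + y) <= p x + p y) /\
  forall r x, 0 < r -> p (of_real r *: x) <= r * p x.

Definition real_linear p := (forall x y, p (x + y) = p x + p y) /\
  forall r x, p (of_real r *: x) = r * p x.

Lemma sublinearZ p r x : sublinear p -> 0 < r -> p (of_real r *: x) = r * p x.
Proof.
move=> [_ pZ] r0; apply/eqP; rewrite eq_le pZ//= -ler_pdivlMl//.
rewrite -[x in leLHS]scale1r -of_real1 -(mulVf (lt0r_neq0 r0)) of_realM.
by rewrite -scalerA pZ// invr_gt0.
Qed.

Lemma sublinear0 p : sublinear p -> p 0 = 0.
Proof.
move=> sp; have := @sublinearZ p 2 0 sp (ltr0Sn _ _); rewrite scaler0; lra.
Qed.

Lemma sublinear_ge p x : sublinear p -> - p (- x) <= p x.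
Proof.
move=> sp; have := sp.1 x (- x); rewrite subrr sublinear0//; lra.
Qed.

Lemma sublinearB p x y : sublinear p -> p x - p y <= p (x - y).
Proof. by move=> sp; have := sp.1 (x - y) y; rewrite subrK lerBlDr. Qed.

(* The largest sublinear functional below [p] whose value at [- y] is at most
   [- p y]. *)
Definition sublinear_push p y x : R :=
  inf [set p (x + of_real t *: y) - t * p y | t in [set t | 0 <= t]].

(** Subadditivity applied to t y = (x + t y) - x. The bound does not depend on t, so the infimum in
    [sublinear_push] is finite. *)
Lemma sublinear_push_lb p y x t : sublinear p -> 0 <= t ->
  - p (- x) <= p (x + of_real t *: y) - t * p y.
Proof.
rewrite le_eqVlt => sp /predU1P[<-|t0].
  by rewrite of_real0 scale0r addr0 mul0r subr0 sublinear_ge.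
have := sublinearB (of_real t *: y) (- x) sp.
rewrite sublinearZ// opprK addrC [_ *: y + _]addrC; lra.
Qed.

Lemma sublinear_push_le p y x t : sublinear p -> 0 <= t ->
  sublinear_push p y x <= p (x + of_real t *: y) - t * p y.
Proof.
move=> sp t0; apply: ge_inf; last by exists t.
by exists (- p (- x)) => _ [s /= s0 <-]; exact: sublinear_push_lb.
Qed.

Lemma sublinear_push_adherent p y x e : sublinear p -> 0 < e -> exists2 t, 0 <= t &
  p (x + of_real t *: y) - t * p y < sublinear_push p y x + e.
Proof.
move=> sp e0; have [|_ [t /= t0 <-] lt_e] := @inf_adherent _
  [set p (x + of_real t *: y) - t * p y | t in [set t | 0 <= t]] _ e0.
  split; first by exists (p (x + of_real 0 *: y) - 0 * p y), 0 => /=.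
  by exists (- p (- x)) => _ [s /= s0 <-]; exact: sublinear_push_lb.
by exists t.
Qed.

(** If s and t nearly realise the infima at u and v, then s + t is admissible for u + v; likewise r
    t is admissible for r x. *)
Lemma sublinear_push_sublinear p y : sublinear p -> sublinear (sublinear_push p y).
Proof.
move=> sp; split=> [u v|r x r0].
  apply/ler_addgt0Pr => e e0; have e20 : 0 < e / 2 by rewrite divr_gt0.
  have [s s0 us] := sublinear_push_adherent y u sp e20.
  have [t t0 vt] := sublinear_push_adherent y v sp e20.
  have := sublinear_push_le y (u + v) sp (addr_ge0 s0 t0).
  have := sp.1 (u + of_real s *: y) (v + of_real t *: y).
  rewrite addrACA -scalerDl -of_realD; lra.
apply/ler_addgt0Pr => e e0; have er0 : 0 < e / r by rewrite divr_gt0.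
have [t t0 xt] := sublinear_push_adherent y x sp er0.
have /(sublinear_push_le y (of_real r *: x) sp) : 0 <= r * t.
  by rewrite mulr_ge0// ltW.
rewrite of_realM -scalerA -scalerDr (sublinearZ _ sp)// -mulrA -mulrBr.
move=> /le_trans; apply.
by rewrite -ler_pdivlMl// mulrDr mulKf ?gt_eqF// [_^-1 * e]mulrC ltW.
Qed.

Lemma sublinear_push_ub p y x : sublinear p -> sublinear_push p y x <= p x.
Proof.
by move=> sp; have := sublinear_push_le y x sp (lexx 0);
  rewrite of_real0 scale0r addr0 mul0r subr0.
Qed.

Lemma sublinear_pushN p y : sublinear p -> sublinear_push p y (- y) <= - p y.
Proof.
by move=> sp; have := sublinear_push_le y (- y) sp ler01;
  rewrite of_real1 scale1r addNr sublinear0// mul1r sub0r.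
Qed.

(** Zorn gives a minimal sublinear functional below [p]. It cannot be lowered by a push, which makes
    it odd, and an odd sublinear functional is linear. *)
Lemma hahn_banach p : sublinear p ->
  exists2 L, real_linear L & forall x, L x <= p x.
Proof.
move=> sp.
pose T := {q : V -> R | sublinear q /\ forall x, q x <= p x}.
(* The order is reversed: a maximal element for [Rel] is a minimal functional. *)
pose Rel (q q' : T) := `[< forall x, sval q' x <= sval q x >].
(* Being uniform in q, this bound keeps the pointwise infimum over a chain finite. *)
have lb (q : T) x : - p (- x) <= sval q x.
  case: q => q [sq qp] /=; have := sublinear_ge x sq; have := qp (- x); lra.
have [||| A totA|[m [sm mp]] mmin] := @Zorn T Rel.
- by move=> q; exact/asboolP.
- move=> q q' q'' /asboolP h /asboolP h'; apply/asboolP => x.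
  exact: le_trans (h x).
- move=> [q hq] [q' hq'] /asboolP h /asboolP h'.
  by apply/eq_exist/funext => x; apply/eqP; rewrite eq_le h h'.
- have [[q0 Aq0]|A0] := pselect (A !=set0); last first.
    by exists (exist _ p (conj sp (fun x => lexx _))) => q Aq; case: A0; exists q.
  pose S x := [set sval q x | q in A]; pose m x := inf (S x).
  have S0 x : has_inf (S x).
    by split; [exists (sval q0 x), q0|exists (- p (- x)) => _ [q _ <-]; exact: lb].
  have m_le x (q : T) : A q -> m x <= sval q x.
    by move=> Aq; apply: ge_inf (S0 x).2 _ _; exists q.
  have m_adh x e : 0 < e -> exists2 q : T, A q & sval q x < m x + e.
    by move=> e0; have [_ [q Aq <-] ?] := inf_adherent e0 (S0 x); exists q.
  have sm : sublinear m.
    split=> [x y|r x r0].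
      apply/ler_addgt0Pr => e e0; have e20 : 0 < e / 2 by rewrite divr_gt0.
      have [q Aq qx] := m_adh x _ e20; have [q' Aq' qy] := m_adh y _ e20.
      (* The functionals nearly optimal at x and at y may differ; in a chain the smaller one serves
         both points. *)
      have [u Au [ux uy]]:
          exists2 u, A u & sval u x <= sval q x /\ sval u y <= sval q' y.
        have [/asboolP h|/asboolP h] := totA _ _ Aq Aq'.
          by exists q' => //; split.
        by exists q => //; split.
      have [su _] := svalP u; have := su.1 x y; have := m_le (x + y) u Au; lra.
    apply/ler_addgt0Pr => e e0; have er0 : 0 < e / r by rewrite divr_gt0.
    have [q Aq qx] := m_adh x _ er0; apply: (le_trans (m_le _ _ Aq)).
    rewrite (sublinearZ _ (svalP q).1)// -ler_pdivlMl// mulrDr mulKf ?gt_eqF//.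
    by rewrite [_^-1 * e]mulrC ltW.
  have mp x : m x <= p x by apply: le_trans (m_le x q0 Aq0) ((svalP q0).2 x).
  by exists (exist _ m (conj sm mp)) => q Aq; apply/asboolP => x; exact: m_le.
have mN y : m (- y) = - m y.
  have spu := sublinear_push_sublinear y sm.
  have pup x : sublinear_push m y x <= p x.
    by apply: le_trans (mp x); exact: sublinear_push_ub.
  (* By minimality [m] equals its own push at [y], whose value at [- y] is at most [- m y]. *)
  have /mmin/(congr1 sval)/= pE :
      Rel (exist _ m (conj sm mp)) (exist _ (sublinear_push m y) (conj spu pup)).
    by apply/asboolP => x; exact: sublinear_push_ub.
  have := sublinear_pushN y sm; rewrite pE.
  have := sublinear_ge y sm; move=> h1 h2; apply/eqP; rewrite eq_le h2/=; lra.
exists m => //; split=> [x y|r x].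
  apply/eqP; rewrite eq_le sm.1/=; have := sm.1 (x + y) (- y).
  by rewrite addrK mN; lra.
have [r0|r0|<-] := ltgtP 0 r; first exact: sublinearZ.
  rewrite -[r]opprK of_realN scaleNr mN sublinearZ ?oppr_gt0//; lra.
by rewrite of_real0 scale0r sublinear0// mul0r.
Qed.

End sublinear.

(** * State spaces and smooth points *)

Section state_space.
Context {R : realType} {k : scalar_kind}.
Notation K := (scalars R k).
Context {E : normedModType K}.
Implicit Types (r : R) (x e : E) (phi psi : dual E).

Lemma real_linear_extension (L : E -> R) : real_linear L ->
  exists f : {linear E -> K^o}, forall x, to_real (f x) = L x.
Proof.
case: k E L => E' L [LD LZ].
  have lL : linear (L : E' -> R^o) by move=> a x y; rewrite LD LZ.
  by exists (HB.pack_for {linear E' -> R^o} (L : E' -> R^o)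
    (GRing.isLinear.Build _ _ _ _ L lL)).
have L0 : L 0 = 0 by have := LD 0 0; rewrite addr0; lra.
have LN (x : E') : L (- x) = - L x by have := LD x (- x); rewrite subrr L0; lra.
(* The complex-linear functional with real part L is x |-> L x - i L (i x). *)
pose f (x : E') : R[i]^o := ((L x) +i* (- L ('i *: x)))%C.
have lf : linear f.
  move=> [a b] x y; rewrite /f.
  have -> : (a +i* b)%C *: x = (a%:C)%C *: x + (b%:C)%C *: ('i *: x).
    rewrite scalerA -scalerDl; congr (_ *: _).
    by apply/eqP; rewrite eq_complex /=; apply/andP; split; apply/eqP; ring.
  have i2 (z : E') : 'i *: ('i *: z) = - z :> E'.
    by rewrite scalerA -expr2 sqr_i scaleN1r.
  have iC (r : R) (z : E') : 'i *: ((r%:C)%C *: z) = (r%:C)%C *: ('i *: z).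
    by rewrite !scalerA mulrC.
  rewrite !scalerDr !iC i2 !LD ![L ((_%:C)%C *: _)]LZ LN.
  apply/eqP; rewrite eq_complex /=; apply/andP; split; apply/eqP; ring.
by exists (HB.pack_for {linear E' -> R[i]^o} (f : E' -> R[i]^o)
  (GRing.isLinear.Build _ _ _ _ f lf)).
Qed.

(** Replace x by b x, with b rotating f x onto its modulus: the real part of f (b x) is then the
    modulus of f x. *)
Lemma rnorm_le_of_to_real (f : {linear E -> K^o}) (C : R) : 0 <= C ->
  (forall x, to_real (f x) <= C * rnorm x) ->
  forall x, rnorm (f x) <= C * rnorm x.
Proof.
move=> C0 fC x; have [b b1 bf] := rotate_norm (f x).
rewrite /rnorm -bf -[b * f x]/(b *: (f x : K^o)) -linearZ (le_trans (fC _))//.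
rewrite rnormZ ler_wpM2l// ler_piMl ?rnorm_ge0//.
by rewrite -(@of_realK R k 1) of_real1 le_to_real.
Qed.

Lemma dual_of_real_linear (L : E -> R) (C : R) : 0 <= C -> real_linear L ->
  (forall x, L x <= C * rnorm x) ->
  exists phi, forall x, to_real (phi x) = L x.
Proof.
move=> C0 /real_linear_extension[f fL] LC.
have fC : forall x, rnorm (f x) <= C * rnorm x.
  by apply: rnorm_le_of_to_real => // x; rewrite fL.
have cf : continuous f.
  apply/linear_bounded_continuous/linear_boundedP.
  near=> r => x; rewrite -[`|f x|]rnormE -[`|x|]rnormE.
  have Cr : of_real C <= r.
    near: r; apply: nbhs_pinfty_ge.
    by rewrite ger0_real// -[leLHS](@of_real0 R k) le_of_real.
  apply: (@le_trans _ _ (of_real C * of_real (rnorm x))).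
    by rewrite -of_realM le_of_real.
  by rewrite ler_wpM2r// -[leLHS](@of_real0 R k) le_of_real rnorm_ge0.
have cf' : (f : E -> K^o) \in @continuous_linear_form R k E.
  by apply/asboolP; split => // a x y; rewrite linearP.
by exists (Dual cf').
Unshelve. all: by end_near. Qed.

Lemma dual_ext phi psi : (forall x, to_real (phi x) = to_real (psi x)) -> phi = psi.
Proof.
move=> h; apply/val_inj/funext => x /=; apply: subr0_eq; apply: normr0_eq0.
have [b _ bE] := rotate_norm (phi x - psi x).
rewrite -[LHS]to_realK// -bE.
have -> : b * (phi x - psi x) = phi (b *: x) - psi (b *: x).
  by rewrite mulrBr !linearZ.
by rewrite to_realB h subrr of_real0.
Qed.

(** States can be tested on real parts: the modulus of phi e is at most 1 while its real part equals
    1, so phi e = 1. *)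
Lemma state_spaceP e phi : `|e| = 1 -> state_space e phi <->
  (forall x, to_real (phi x) <= rnorm x) /\ to_real (phi e) = 1.
Proof.
move=> e1; have e1' : rnorm e = 1 by rewrite /rnorm e1 -of_real1 of_realK.
split=> [[n1 pe]|[le1 pe]].
  split=> [x|]; last by rewrite pe -of_real1 of_realK.
  apply: le_trans (ler_to_real_norm _) _; apply: le_trans (dual_norm_ub phi x) _.
  have -> : dual_norm phi = 1; last by rewrite mul1r.
  by have := congr1 to_real n1; rewrite dual_normE of_realK -of_real1 of_realK.
have nle x : rnorm (phi x) <= rnorm x.
  have := @rnorm_le_of_to_real phi 1 ler01 _ x; rewrite mul1r; apply=> y.
  by rewrite mul1r; exact: le1.
have pe1 : phi e = 1.
  have pE : phi e = `|phi e|.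
    by apply: ger0_of_to_real; rewrite pe -e1'; exact: nle.
  by rewrite pE -[LHS]to_realK// -pE pe of_real1.
split=> //; rewrite dual_normE -of_real1; congr of_real; apply/eqP.
rewrite eq_le; apply/andP; split.
  apply: dual_norm_le => x x1; rewrite (le_trans (nle x))//.
  by rewrite /rnorm -(@of_realK R k 1) of_real1 le_to_real.
have := @dual_norm_ub1 R k E phi e; rewrite e1 lexx => /(_ isT).
by rewrite pe1 /rnorm normr1 -of_real1 of_realK.
Qed.

Lemma rnorm_sublinear : sublinear (@rnorm R k E).
Proof.
split=> [|r x r0]; first exact: ler_rnormD.
by rewrite rnorm_scale_real gtr0_norm.
Qed.

(** Hahn-Banach is applied to the norm pushed at [e]. This forces L (- e) to be at most minus the
    norm of e, so no extension from the line through [e] is needed. *)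
Lemma norming_functional e : exists2 phi : dual E,
  (forall x, to_real (phi x) <= rnorm x) & to_real (phi e) = rnorm e.
Proof.
have [L rL Lp] := hahn_banach (sublinear_push_sublinear e rnorm_sublinear).
have LE x : L x <= 1 * rnorm x.
  by rewrite mul1r (le_trans (Lp x))// sublinear_push_ub//; exact: rnorm_sublinear.
have [phi pL] := dual_of_real_linear ler01 rL LE.
exists phi => [x|]; first by rewrite pL -[leRHS]mul1r.
apply/eqP; rewrite pL eq_le -[leRHS]mul1r LE/=.
have := le_trans (Lp (- e)) (sublinear_pushN e rnorm_sublinear).
rewrite -scaleN1r -of_real1 -of_realN rL.2; lra.
Qed.

(** For two states, adding the bounds on phi1 (e + t x) and phi2 (e - t x) yields phi1 x - phi2 x <=
    d in real parts. One t for each d is enough, and exchanging the states gives equality. *)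
Lemma smooth_of_derivative e : `|e| = 1 ->
  (forall x (d : R), 0 < d -> exists2 t : R, 0 < t &
    rnorm (e + of_real t *: x) + rnorm (e - of_real t *: x) - 2 <= d * t) ->
  smooth e.
Proof.
move=> e1 he; split=> //.
have e1' : rnorm e = 1 by rewrite /rnorm e1 -of_real1 of_realK.
have [phi ple pe] := norming_functional e.
exists phi; apply/seteqP; split=> [psi|_ ->]; last first.
  by apply/(state_spaceP _ e1); rewrite pe.
move=> /(state_spaceP _ e1)[psile psie].
suff h (phi1 phi2 : dual E) x : (forall x, to_real (phi1 x) <= rnorm x) ->
    to_real (phi1 e) = 1 -> (forall x, to_real (phi2 x) <= rnorm x) ->
    to_real (phi2 e) = 1 -> to_real (phi1 x) <= to_real (phi2 x).
  by apply/dual_ext => x; apply/eqP; rewrite eq_le !h// pe.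
move=> le1 p1e le2 p2e; apply/ler_addgt0Pr => d d0.
have [t t0 ht] := he x d d0.
have := le1 (e + of_real t *: x); have := le2 (e - of_real t *: x).
have toZ (f : dual E) : to_real (f (of_real t *: x)) = t * to_real (f x).
  by rewrite linearZ; exact: to_real_scale.
rewrite linearB linearD to_realB to_realD p1e p2e !toZ => h1 h2.
rewrite -lerBlDl -(ler_pM2l t0) [t * d]mulrC; lra.
Qed.

End state_space.

(** * Weak compactness *)

Section weak_compactness.
Context {R : realType} {k : scalar_kind}.
Notation K := (scalars R k).
Context {E : normedModType K}.
Implicit Types (A : set E).

Lemma weak_eval_continuous (phi : dual E) :
  continuous (fun x : weak_topology E => phi x : K^o).
Proof.
move=> x; apply: (@continuous_comp _ _ _
  ((fun x phi => phi x) : weak_topology E -> {ptws dual E -> K^o})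
  (fun f => f phi)).
  exact: initial_continuous.
exact: (@proj_continuous _ (fun=> K^o) phi).
Qed.

(** The identity from the norm topology to the weak topology is continuous, so the norm compact case
    reduces to the weak one. *)
Lemma compact_weakly_compact A : compact A -> weakly_compact A.
Proof.
move=> cA; rewrite /weakly_compact -[X in compact X](image_id A).
apply: (@continuous_compact E (weak_topology E) id) cA.
apply: continuous_subspaceT.
apply: (@continuous_comp_initial E) => x; apply/cvg_sup => phi.
apply: (@continuous_comp_initial _ _ K^o (fun f : {ptws dual E -> K^o} => f phi)
  (fun (x : E) (phi : dual E) => phi x)).
exact: dual_continuous.
Qed.

(** A cluster point approximates along indices that depend on the functional. Testing one functional
    at a time, this replaces a convergent subsequence. *)
Lemma weakly_compact_cluster A (u : nat -> E) : weakly_compact A ->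
  (forall n, A (u n)) ->
  exists2 x, A x & forall (phi : dual E) (d : R) N, 0 < d ->
    exists2 n, (N <= n)%N & `|to_real (phi (u n)) - to_real (phi x)| < d.
Proof.
move=> wA uA; have [|x [Ax xcl]] := wA (u @ \oo) _.
  by exists 0%N => // n _; exact: uA.
exists x => // phi d N d0.
pose B := [set y : weak_topology E | `|phi x - phi y| < of_real d].
have [||_ [[n Nn <-] /= Bn]] := xcl (u @` [set n | (N <= n)%N]) B.
- by exists N => // n /= Nn; exists n.
- have /cvgrPdist_lt := @weak_eval_continuous phi x; apply.
  by rewrite -[ltLHS](@of_real0 R k) lt_of_real.
have {}Bn : rnorm (phi x - phi (u n) : K^o) < d.
  by rewrite -(@lt_of_real R k) rnormE.
exists n => //; rewrite distrC; apply: le_lt_trans Bn.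
rewrite -to_realB ler_norml ler_to_real_norm andbT.
by rewrite lerNl -to_realN -rnormN; exact: ler_to_real_norm.
Qed.

End weak_compactness.

(** * Weak-star limits in the bidual and the double limit obstruction *)

Section bidual.
Context {R : realType} {k : scalar_kind}.
Notation K := (scalars R k).
Context {E : normedModType K}.

Lemma dual_le_rnorm (phi : dual E) (x : E) : rnorm x <= 1 ->
  `|to_real (phi x)| <= dual_norm phi.
Proof.
move=> x1; have h (y : E) : rnorm y <= 1 -> to_real (phi y) <= dual_norm phi.
  move=> y1; apply: le_trans (ler_to_real_norm _) _; apply: dual_norm_ub1.
  by rewrite -rnormE -(@of_real1 R k) le_of_real.
by rewrite ler_norml lerNl -to_realN -linearN !h//= rnormN.
Qed.

(* An element of the bidual obtained as a weak-star limit of the sequence [u]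
   along a nonprincipal ultrafilter. *)
Lemma bidual_limit (u : nat -> E) : (forall n, rnorm (u n) <= 1) ->
  exists Phi : dual (dual E), forall (phi : dual E) (l : R),
    (\forall n \near \oo, to_real (phi (u n)) = l) -> to_real (Phi phi) = l.
Proof.
move=> u1.
have [U [UU ooU]] := ultraFilterLemma (@eventually_filter).
(* The values stay in a compact segment, and a cluster point along an ultrafilter is a limit. *)
have cvU (phi : dual E) : exists l : R,
    `|l| <= dual_norm phi /\ to_real (phi (u n)) @[n --> U] --> l.
  have [|l [ldn lcl]] := @segment_compact R (- dual_norm phi) (dual_norm phi)
      (to_real (phi (u n)) @[n --> U]) _.
    by apply: (@filterE _ U) => n /=; rewrite in_itv/= -ler_norml dual_le_rnorm.
  exists l; split=> [|B Bl]; first by move: ldn; rewrite /= in_itv/= -ler_norml.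
   have [//|UB] := in_ultra_setVsetC
    ((fun n => to_real (phi (u n))) @^-1` B) UU.
  by have [x [nB xB]] := lcl (~` B) B UB Bl.
have {cvU}[L LUL] := choice cvU; have LU phi := (LUL phi).2.
have rL : real_linear L.
  split=> [phi psi|r phi].
    apply: (@norm_cvg_unique _ _ ((fun n => to_real ((phi + psi) (u n))) @ U)).
      exact: LU.
    rewrite (_ : (fun _ => _) =
      (fun n => to_real (phi (u n)) + to_real (psi (u n)))).
      by apply: cvgD; exact: LU.
    by apply/funext => n; exact: to_realD.
  apply: (@norm_cvg_unique _ _ ((fun n => to_real ((of_real r *: phi) (u n))) @ U)).
    exact: LU.
  rewrite (_ : (fun _ => _) = (fun n => r * to_real (phi (u n)))).
    by apply: cvgMr; exact: LU.
  by apply/funext => n; exact: to_real_scale.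
have LE phi : L phi <= 1 * rnorm phi.
  rewrite mul1r /rnorm dual_normE of_realK.
  by rewrite (le_trans (ler_norm _))//; have [] := LUL phi.
have [Phi PhiL] := dual_of_real_linear ler01 rL LE.
exists Phi => phi l oo_l; have Ul := ooU _ oo_l; rewrite PhiL.
apply: (@norm_cvg_unique _ _ ((fun n => to_real (phi (u n))) @ U)); first exact: LU.
exact: cvg_near_cst.
Qed.

(** The iterated limits of psi_n (u_j) disagree: -1 when n goes to infinity first, 1 when j does. *)
Lemma not_weakly_compact (A : set (dual E)) (u : nat -> E) (psi : nat -> dual E) :
  (forall n, rnorm (u n) <= 1) -> (forall n, A (psi n)) ->
  (forall n j, to_real (psi n (u j)) = if (n <= j)%N then 1 else -1) ->
  ~ weakly_compact A.
Proof.
move=> u1 Apsi psiu wA; have [psi0 _ cl] := weakly_compact_cluster wA Apsi.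
have psi0u j : to_real (psi0 (u j)) = -1.
  (* For a constant sequence the weak-star limit is evaluation at [u j], seen in the bidual. *)
  have [e eE] := bidual_limit (fun _ => u1 j).
  have {}eE (phi : dual E) : to_real (e phi) = to_real (phi (u j)).
    by apply: eE; exact: filterE.
  apply/eqP; rewrite -subr_eq0 -normr_le0; apply/ler_addgt0Pr => d d0.
  (* Starting at [j.+1] ensures j < n, where the prescribed value is -1. *)
  have [n jn] := cl e d j.+1 d0.
  by rewrite !eE psiu leqNgt jn/= add0r distrC => /ltW.
have [Phi PhiE] := bidual_limit u1.
have PhiN : to_real (Phi psi0) = -1 by apply: PhiE; exact: filterE.
(* Any index will do: the values 1 and -1 are at distance 2, contradicting the tolerance 1. *)
have [n _] := cl Phi 1 0%N ltr01.
have -> : to_real (Phi (psi n)) = 1.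
  by apply: PhiE; exists n => // j /= nj; rewrite psiu nj.
by rewrite PhiN opprK ger0_norm ?addr_ge0// gtrDl ltr10.
Qed.

End bidual.

(** * Lebesgue measure on the unit interval *)

Section atomless.
Context {R : realType}.
Notation mu := (@completed_lebesgue_measure R).
Notation I := (`[0, 1]%classic : set R).
Notation lebesgue_measurable := (((@wlength R idfun)^*)%mu.-cara.-measurable).
Implicit Types A B : set R.

Lemma lebesgue_measurable_itv (a b : R) : lebesgue_measurable `[a, b]%classic.
Proof. by apply: sub_caratheodory; exact: measurable_itv. Qed.

Lemma completed_lebesgue_measure_itv_le (a e : R) : 0 <= e ->
  (mu `[a, (a + e)%R]%classic <= e%:E)%E.
Proof.
move=> e0; rewrite [leLHS](_ : _ = @lebesgue_measure R `[a, (a + e)%R]%classic)//.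
rewrite lebesgue_measure_itv/=; case: ifPn => // _.
by rewrite -EFinB lee_fin addrAC subrr add0r.
Qed.

Lemma completed_lebesgue_measure_lty A : lebesgue_measurable A -> A `<=` I ->
  (mu A < +oo)%E.
Proof.
move=> mA AI; apply: (@le_lt_trans _ _ (mu I)).
  by apply: le_measure; rewrite ?inE//; exact: measurable_unit_itv.
by rewrite completed_lebesgue_measure_unit_itv ltry.
Qed.

(** Bisection: by subadditivity, the two halves of an interval cannot both meet A in a null set. *)
Lemma dyadic_itv_gt0 A n : lebesgue_measurable A -> A `<=` I -> (0 < mu A)%E ->
  exists a : R, (0 < mu (A `&` `[a, (a + 2 ^- n)%R]%classic))%E.
Proof.
move=> mA AI A0; elim: n => [|n [a aA]].
  exists 0; rewrite expr0 invr1 add0r.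
  by rewrite (_ : A `&` _ = A)//; exact/setIidPl.
pose m := a + 2 ^- n.+1.
have [am|am] := ltP 0%E (mu (A `&` `[a, m]%classic)); first by exists a.
exists m; rewrite ltNge; apply/negP => mn; move: aA; apply/negP; rewrite -leNgt.
have mI (b c : R) : lebesgue_measurable (A `&` `[b, c]%classic).
  by apply: measurableI => //; exact: lebesgue_measurable_itv.
apply: (@le_trans _ _ (mu ((A `&` `[a, m]%classic) `|`
    (A `&` `[m, (m + 2 ^- n.+1)%R]%classic)))).
  apply: le_measure; rewrite ?inE//; first exact: measurableU.
  have -> : a + 2 ^- n = m + 2 ^- n.+1.
    rewrite /m -addrA; congr (a + _); rewrite exprS invfM; lra.
  move=> t [At]; rewrite /= !in_itv/= => /andP[at_ tb].
  have [tm|/ltW mt] := leP t m; [left|right]; split => //=;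
    by rewrite ?in_itv/= ?at_ ?tm ?mt.
apply: (le_trans (measureU2 mu (mI _ _) (mI _ _))).
by rewrite -[leRHS]adde0 leeD.
Qed.

(** Cut A by an interval of length 2^-n < mu A that still meets it in positive measure. *)
Lemma completed_lebesgue_measure_atomless A :
  lebesgue_measurable A -> A `<=` I -> (0 < mu A)%E ->
  exists B, [/\ lebesgue_measurable B, B `<=` A, (0 < mu B)%E & (mu B < mu A)%E].
Proof.
move=> mA AI A0; have Afin := completed_lebesgue_measure_lty mA AI.
have fA0 : 0 < fine (mu A) by rewrite fine_gt0// A0.
have [n _ /(_ n (leqnn n)) nA] := near_infty_natSinv_expn_lt (PosNum fA0).
have [a aA] := dyadic_itv_gt0 n mA AI A0.
have mB : lebesgue_measurable (A `&` `[a, (a + 2 ^- n)%R]%classic).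
  by apply: measurableI => //; exact: lebesgue_measurable_itv.
exists (A `&` `[a, (a + 2 ^- n)%R]%classic); split => //.
apply: (@le_lt_trans _ _ (2 ^- n)%R%:E).
  apply: le_trans (completed_lebesgue_measure_itv_le a _).
    by apply: le_measure; rewrite ?inE//; exact: lebesgue_measurable_itv.
  by rewrite invr_ge0 exprn_ge0.
by rewrite -[ltRHS]fineK ?ge0_fin_numE// lte_fin -[ltLHS]div1r.
Qed.

Lemma exists_shrinking_sets A :
  lebesgue_measurable A -> A `<=` I -> (0 < mu A)%E ->
  exists B : nat -> set R, [/\ B 0%N `<=` A, forall n, lebesgue_measurable (B n),
    forall n, B n.+1 `<=` B n & forall n, (0 < mu (B n `\` B n.+1))%E].
Proof.
move=> mA AI A0.
pose good A := [/\ lebesgue_measurable A, A `<=` I & (0 < mu A)%E].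
(* Guarding the conclusion by [good] makes the selection total, so that it can be iterated. *)
have /choice[F FP] : forall A, exists B, good A ->
    [/\ lebesgue_measurable B, B `<=` A, (0 < mu B)%E & (mu B < mu A)%E].
  move=> C; have [[mC CI C0]|nC] := pselect (good C); last by exists C.
  by have [B BP] := completed_lebesgue_measure_atomless mC CI C0; exists B.
pose B n := iter n F A.
have gB n : good (B n).
  elim: n => [|n IH]; first by split.
  have [mF FB F0 _] := FP _ IH; have [_ BI _] := IH.
  by split => //; exact: subset_trans BI.
exists B; split => //.
- by move=> n; have [] := gB n.
- by move=> n; have [_ FB _ _] := FP _ (gB n).
move=> n; have [mB BI _] := gB n; have [mF FB _ ltB] := FP _ (gB n).
have Bfin := completed_lebesgue_measure_lty mB BI.
by rewrite measureD// setIidr// sube_gt0.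
Qed.

End atomless.

(** * Functions vanishing on a set of positive measure *)

Section L1_norm.
Context {R : realType} {k : scalar_kind}.
Notation K := (scalars R k).
Notation lebesgueT := (caratheodory_type ((@wlength R idfun)^*)%mu).
Notation mu := (@completed_lebesgue_measure R).
Notation I := (`[0, 1]%classic : set R).
Notation lebesgue_measurable := (((@wlength R idfun)^*)%mu.-cara.-measurable).
Local Open Scope quotient_scope.
Context {X : normedModType K}.
Implicit Types (f g : bochner X) (A : set R).

Lemma completed_lebesgue_measure_unit_itv_lty : (mu I < +oo)%E.
Proof. by rewrite completed_lebesgue_measure_unit_itv ltry. Qed.

Lemma rnorm_L1 f : rnorm (\pi_(L1 X) f) = \int[mu]_(t in I) rnorm (f t).
Proof. by rewrite /rnorm L1_normE of_realK. Qed.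

Lemma integrable_rnorm f : mu.-integrable I (EFin \o (fun t => rnorm (f t))).
Proof.
apply/integrableP; split.
  apply: strongly_measurable_rnorm.
  - exact: completed_lebesgue_measure_is_complete.
  - exact: measurable_unit_itv.
  - by have [] := bochnerP f.
under eq_integral do rewrite /= ger0_norm ?rnorm_ge0//.
apply: bochner_integrable_lty (bochnerP f).
- exact: completed_lebesgue_measure_is_complete.
- exact: measurable_unit_itv.
- exact: completed_lebesgue_measure_unit_itv_lty.
Qed.

Lemma simple_bochner_subproof (s : R -> X) :
  simple_on (I : set lebesgueT) s -> s \in @bochner_pred R k X.
Proof.
move=> ss; apply/asboolP; split; first exact: simple_on_strongly_measurable.
exists (fun=> s) => //; rewrite (_ : (fun _ : nat => _) = cst 0%E); first exact: cvg_cst.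
by apply/funext => n; apply: integral0_eq => t _; rewrite subrr rnorm0.
Qed.

(** Membership is boolean-valued, so step functions on several sets arise from it by
    [simple_on_pair] and [simple_on_comp]. *)
Lemma simple_on_mem A :
  lebesgue_measurable A -> simple_on (I : set lebesgueT) (fun t => t \in A).
Proof.
move=> mA; split; first exact: finite_finset.
move=> b; apply: measurableI; first exact: measurable_unit_itv.
case: b.
  rewrite (_ : _ @^-1` _ = A)//.
  by apply/seteqP; split => t /=; [move/set_mem|move/mem_set].
rewrite (_ : _ @^-1` _ = ~` A); first exact: measurableC.
by apply/seteqP; split => t /=; [move=> h /mem_set; rewrite h|exact: memNset].
Qed.

Lemma integral_indic_unit_itv A : lebesgue_measurable A -> A `<=` I ->
  \int[mu]_(t in I) \1_A t = fine (mu A).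
Proof.
move=> mA AI; rewrite /Rintegral integral_indic//; last exact: measurable_unit_itv.
by rewrite (_ : A `&` _ = A)//; exact/setIidPl.
Qed.

Lemma integrable_indic_unit_itv A : lebesgue_measurable A ->
  mu.-integrable I (EFin \o (\1_A : R -> R)).
Proof.
move=> mA; apply/integrableP; split.
  by apply/measurable_EFinP; exact: measurable_funTS.
under eq_integral do rewrite /= ger0_norm//.
rewrite integral_indic//; last exact: measurable_unit_itv.
apply: le_lt_trans completed_lebesgue_measure_unit_itv_lty.
apply: le_measure; rewrite ?inE//; last exact: measurable_unit_itv.
by apply: measurableI => //; exact: measurable_unit_itv.
Qed.

Lemma rnorm_L1_indic f A : lebesgue_measurable A -> A `<=` I ->
  (forall t, I t -> rnorm (f t) = \1_A t) -> rnorm (\pi_(L1 X) f) = fine (mu A).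
Proof.
move=> mA AI fA; rewrite rnorm_L1 -integral_indic_unit_itv//.
by apply: eq_Rintegral => t; rewrite inE; exact: fA.
Qed.

(** The common shape of [sign_step] and [bump], which are padded with zero coefficients. *)
Lemma step_bochner_subproof (x : X) (a b c : R) A B C :
  lebesgue_measurable A -> lebesgue_measurable B -> lebesgue_measurable C ->
  (fun t => of_real (a * \1_A t + b * \1_B t + c * \1_C t) *: x)
    \in @bochner_pred R k X.
Proof.
move=> mA mB mC; apply: simple_bochner_subproof.
have := simple_on_pair (simple_on_pair (simple_on_mem mA) (simple_on_mem mB))
  (simple_on_mem mC).
move=> /(simple_on_comp (fun p : bool * bool * bool =>
  of_real (a * p.1.1%:R + b * p.1.2%:R + c * p.2%:R) *: x)).
by congr simple_on; apply/funext => t /=; rewrite !indicE.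
Qed.

End L1_norm.

(** * States with prescribed signs on a shrinking sequence inside the zero set *)

Section shrinking_zero_set.
Context {R : realType} {k : scalar_kind}.
Notation K := (scalars R k).
Notation mu := (@completed_lebesgue_measure R).
Notation I := (`[0, 1]%classic : set R).
Notation lebesgue_measurable := (((@wlength R idfun)^*)%mu.-cara.-measurable).
Local Open Scope quotient_scope.
Context {X : normedModType K}.
Variables (f : bochner X) (x : X) (Z : set R) (B : nat -> set R).
Hypotheses (f1 : rnorm (\pi_(L1 X) f) = 1) (x1 : rnorm x = 1).
Hypotheses (mZ : lebesgue_measurable Z) (ZI : Z `<=` I)
  (Zf : forall t, Z t -> f t = 0).
Hypotheses (BZ : B 0%N `<=` Z) (mB : forall n, lebesgue_measurable (B n)).
Hypotheses (BS : forall n, B n.+1 `<=` B n)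
  (B0 : forall n, (0 < mu (B n `\` B n.+1))%E).

Let D n := B n `\` B n.+1.
Let mD n : lebesgue_measurable (D n). Proof. exact: measurableD. Qed.

Let B_sub m n : (m <= n)%N -> B n `<=` B m.
Proof.
elim: n => [|n IH]; first by rewrite leqn0 => /eqP ->.
by rewrite leq_eqVlt => /predU1P[->//|/IH]; exact: subset_trans.
Qed.

Let BnZ n : B n `<=` Z. Proof. exact: subset_trans (B_sub (leq0n n)) BZ. Qed.
Let DZ n : D n `<=` Z. Proof. by move=> t [/BnZ]. Qed.

(* [x] on [B n] and [- x] on the rest of [Z] *)
Definition sign_step n : bochner X :=
  Bochner (step_bochner_subproof x 2 (-1) 0 (mB n) mZ mZ).

Definition bump n : bochner X :=
  Bochner (step_bochner_subproof x 1 0 0 (mD n) mZ mZ).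

(** The sign of [sign_step n] on [D j]: this set lies in [B n] when n <= j, and is disjoint from it
    when j < n. *)
Let sgn n j : R := if (n <= j)%N then 1 else -1.

Let sign_stepB n j t :
  `|2 * \1_(B n) t - \1_Z t - sgn n j * \1_(D j) t| = \1_(Z `\` D j) t :> R.
Proof.
rewrite !indicE.
have tBZ : t \in B n -> t \in Z by rewrite !inE; exact: BnZ.
have tDZ : t \in D j -> t \in Z by rewrite !inE; exact: DZ.
have tDB : t \in D j -> (t \in B n) = (n <= j)%N.
  rewrite !inE => -[tj tj']; apply/idP/idP; rewrite ?inE.
    by move=> tn; rewrite leqNgt; apply/negP => /B_sub/(_ _ tn).
  by move=> /B_sub; exact.
have -> : (t \in Z `\` D j) = (t \in Z) && (t \notin D j) by rewrite in_setD.
rewrite /sgn; move: tDB tDZ tBZ;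
  case: (t \in D j) => [/(_ isT) -> /(_ isT) -> _|_ _].
  by apply/eqP; rewrite normr_eq0; apply/eqP; case: (n <= j)%N => /=; ring.
case: (t \in B n) => [/(_ isT) -> /=|_].
  by rewrite (_ : _ - _ = 1) ?normr1//; ring.
by rewrite !mulr0 subr0 sub0r normrN ger0_norm// andbT.
Qed.

Lemma rnorm_bump n : rnorm (\pi_(L1 X) (bump n)) = fine (mu (D n)).
Proof.
apply: rnorm_L1_indic => // [|t It]; first exact: subset_trans ZI.
rewrite /= !mul0r !addr0 mul1r rnorm_scale_real x1 mulr1.
by rewrite ger0_norm// indicE.
Qed.

(** Subtracting the signed bump erases the step on [D j] and leaves a vector of norm 1 on the rest
    of [Z]. *)
Lemma rnorm_sign_step_sub n j :
  rnorm (\pi_(L1 X) (sign_step n - of_real (sgn n j) *: bump j)) =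
  fine (mu Z) - fine (mu (D j)).
Proof.
have Zfin := completed_lebesgue_measure_lty mZ ZI.
have Dfin := completed_lebesgue_measure_lty (mD j) (subset_trans (@DZ j) ZI).
rewrite -fineB ?ge0_fin_numE// -[in RHS](setIidr (@DZ j)) -measureD//.
apply: rnorm_L1_indic => [||t It]; first exact: measurableD.
  by apply: subset_trans ZI; exact: subDsetl.
rewrite -[LHS]/(rnorm (sign_step n t - of_real (sgn n j) *: bump j t)) /=.
rewrite scalerA -scalerBl -of_realM -of_realN -of_realD.
rewrite rnorm_scale_real x1 mulr1 -(sign_stepB n); congr `|_|; lra.
Qed.

(** The two supports are disjoint: [f] vanishes on [Z] and the step vanishes off [Z]. *)
Lemma rnorm_add_sign_step n :
  rnorm (\pi_(L1 X) (f + sign_step n)) = 1 + fine (mu Z).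
Proof.
rewrite -f1 !rnorm_L1 -integral_indic_unit_itv// -RintegralD//; first last.
- exact: integrable_indic_unit_itv.
- exact: integrable_rnorm.
- exact: measurable_unit_itv.
apply: eq_Rintegral => t _.
rewrite -[LHS]/(rnorm (f t + sign_step n t)) /= mul0r addr0 !indicE.
have tBZ : t \in B n -> t \in Z by rewrite !inE; exact: BnZ.
have : t \in Z -> f t = 0 by rewrite inE; exact: Zf.
move: tBZ; case: (t \in Z) => [_ /(_ isT) ->|]; last first.
  case: (t \in B n) => [/(_ isT)//|_ _].
  by rewrite !mulr0 addr0 of_real0 scale0r !addr0.
rewrite add0r rnorm0 add0r rnorm_scale_real x1 mulr1.
case: (t \in B n); rewrite /= ?mulr1 ?mulr0.
  by rewrite (_ : 2 + -1 = 1 :> R) ?normr1//; lra.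
by rewrite add0r normrN normr1.
Qed.

(** Split [f + sign_step n] into [f], the step off [D j], and the signed bump. Their norms add up to
    the norm of the sum, which [psi] attains, so [psi] attains the norm of each piece. *)
Lemma state_sign n : exists2 psi : dual (L1 X), state_space (\pi_(L1 X) f) psi &
  forall j, to_real (psi (\pi_(L1 X) (bump j))) = sgn n j * fine (mu (D j)).
Proof.
have [psi psi_le psi_eq] := norming_functional (\pi_(L1 X) (f + sign_step n)).
have split_eq j : to_real (psi (\pi_(L1 X) f)) = 1 /\
    to_real (psi (\pi_(L1 X) (bump j))) = sgn n j * fine (mu (D j)).
  have h1 := psi_le (\pi_(L1 X) f).
  have h2 := psi_le (of_real (sgn n j) *: \pi_(L1 X) (bump j)).
  have h3 := psi_le (\pi_(L1 X) (sign_step n - of_real (sgn n j) *: bump j)).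
  have sE : \pi_(L1 X) (f + sign_step n) = \pi_(L1 X) f +
     (\pi_(L1 X) (sign_step n - of_real (sgn n j) *: bump j) +
      of_real (sgn n j) *: \pi_(L1 X) (bump j)).
    by rewrite -L1_pi_scale -!L1_piD subrK.
  have sgn1 : `|sgn n j| = 1 by rewrite /sgn; case: ifP => _; rewrite ?normrN normr1.
  move: psi_eq; rewrite rnorm_add_sign_step sE !linearD !to_realD.
  have bE : to_real (psi (of_real (sgn n j) *: \pi_(L1 X) (bump j))) =
      sgn n j * to_real (psi (\pi_(L1 X) (bump j))).
    by rewrite linearZ; exact: to_real_scale.
  move: h1 h2 h3; rewrite rnorm_sign_step_sub rnorm_scale_real sgn1 mul1r.
  rewrite rnorm_bump f1 bE.
  move=> h1 h2 h3 h4; split; first lra.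
  have : sgn n j * to_real (psi (\pi_(L1 X) (bump j))) = fine (mu (D j)) by lra.
  by rewrite /sgn; case: ifP => _; lra.
exists psi => [|j]; last by have [] := split_eq j.
apply/state_spaceP; last by split => //; have [] := split_eq 0%N.
by rewrite -rnormE f1 of_real1.
Qed.

Lemma zero_set_not_weakly_compact : ~ weakly_compact (state_space (\pi_(L1 X) f)).
Proof.
have D0 j : 0 < fine (mu (D j)).
  rewrite fine_gt0// B0/=.
  exact: completed_lebesgue_measure_lty (mD j) (subset_trans (@DZ j) ZI).
have /choice[psi psiP] : forall n, exists psi : dual (L1 X),
    state_space (\pi_(L1 X) f) psi /\
    forall j, to_real (psi (\pi_(L1 X) (bump j))) = sgn n j * fine (mu (D j)).
  by move=> n; have [psi ? ?] := state_sign n; exists psi.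
apply: (@not_weakly_compact _ _ _ _
  (fun j => of_real (fine (mu (D j)))^-1 *: \pi_(L1 X) (bump j)) psi).
- move=> j; have Dj0 := D0 j.
  by rewrite rnorm_scale_real rnorm_bump gtr0_norm ?invr_gt0// mulVf ?gt_eqF.
- by move=> n; have [] := psiP n.
move=> n j; rewrite linearZ -[LHS]/(to_real (of_real _ * _)) to_real_scale.
by rewrite (psiP n).2 mulrCA mulVf ?gt_eqF// mulr1.
Qed.

End shrinking_zero_set.

(** * Almost everywhere nonzero functions *)

Section absL1_smooth.
Context {R : realType} {k : scalar_kind}.
Notation K := (scalars R k).
Notation mu := (@completed_lebesgue_measure R).
Notation I := (`[0, 1]%classic : set R).
Local Open Scope quotient_scope.

(** The lower bound comes from 2 a = (a + z) + (a - z). The upper bound supplies the dominating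
    function for the difference quotients. *)
Lemma rnorm_second_diff_bound (V : normedModType K) (a z : V) :
  0 <= rnorm (a + z) + rnorm (a - z) - 2 * rnorm a <= 2 * rnorm z.
Proof.
have h1 := ler_rnormD a z; have h2 := ler_rnormD a (- z).
have h3 := ler_rnormD (a + z) (a - z).
have a2 : a + z + (a - z) = of_real 2 *: a.
  by rewrite addrACA subrr addr0 of_realD of_real1 scalerDl scale1r.
rewrite a2 rnorm_scale_real ger0_norm// in h3; rewrite rnormN in h2.
by apply/andP; split; lra.
Qed.

(* With a = |g + z| and b = |g - z|, AM-GM gives 2ga <= g^2 + a^2 and
   2gb <= g^2 + b^2, while a^2 + b^2 = 2g^2 + 2|z|^2. *)
Lemma rnorm_second_diff_quadratic (g : R) (z : K^o) : 0 < g ->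
  rnorm (of_real g + z : K^o) + rnorm (of_real g - z : K^o) - 2 * g
    <= rnorm z ^+ 2 / g.
Proof.
move=> g0; have hp := sqr_to_real_norm g z; have hm := sqr_to_real_norm g (- z).
rewrite -!/(rnorm (_ : K^o)) to_realN rnormN in hp hm.
rewrite ler_pdivlMr//.
have := sqr_ge0 (g - rnorm (of_real g + z : K^o)).
have := sqr_ge0 (g - rnorm (of_real g - z : K^o)).
rewrite !sqrrB hp hm; lra.
Qed.

Lemma second_diff_integral (V : normedModType K) (e h : bochner V) (c : R) :
  let g t := c^-1 * (rnorm (e t + of_real c *: h t) +
    rnorm (e t - of_real c *: h t) - 2 * rnorm (e t)) in
  mu.-integrable I (EFin \o g) /\
  \int[mu]_(t in I) g t =
    c^-1 * (rnorm (\pi_(L1 V) e + of_real c *: \pi_(L1 V) h) +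
      rnorm (\pi_(L1 V) e - of_real c *: \pi_(L1 V) h) -
      2 * rnorm (\pi_(L1 V) e)).
Proof.
move=> g; have mI := @measurable_unit_itv R.
have iD := integrable_rnorm (e + of_real c *: h).
have iB := integrable_rnorm (e - of_real c *: h).
have ie := integrable_rnorm e.
have i2 : mu.-integrable I (EFin \o (fun t => 2 * rnorm (e t))).
  exact: (integrableZl mI 2 ie).
have iDB : mu.-integrable I (EFin \o (fun t =>
    rnorm ((e + of_real c *: h) t) + rnorm ((e - of_real c *: h) t))).
  exact: (integrableD mI iD iB).
have iDBe : mu.-integrable I (EFin \o (fun t =>
    rnorm ((e + of_real c *: h) t) + rnorm ((e - of_real c *: h) t) -
    2 * rnorm (e t))).
  exact: (integrableB mI iDB i2).
split; first exact: (integrableZl mI c^-1 iDBe).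
rewrite -!L1_pi_scale -scaleN1r -!L1_pi_scale -!L1_piD !rnorm_L1 scaleN1r.
rewrite -(RintegralZl 2 mI ie) -(RintegralD mI iD iB) -(RintegralB mI iDB i2).
by rewrite -(RintegralZl c^-1 mI iDBe).
Qed.

Lemma absL1_smooth (X : normedModType K) (f : bochner X) :
  rnorm (\pi_(L1 X) f) = 1 -> {ae mu, forall t, I t -> f t != 0} ->
  smooth (absL1 (\pi_(L1 X) f)).
Proof.
move=> f1 f0; have mI := @measurable_unit_itv R.
rewrite absL1_pi; set e := abs_bochner f.
have eE t : rnorm (e t) = rnorm (f t) by rewrite /rnorm /= normr_id.
have e1 : rnorm (\pi_(L1 K^o) e) = 1.
  by rewrite -f1 !rnorm_L1; apply: eq_Rintegral => t _; exact: eE.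
apply: smooth_of_derivative; first by rewrite -rnormE e1 of_real1.
elim/quotW => h d d0.
(* Dominated convergence is run along the steps t = 1 / (n + 1). *)
pose c n : R := n.+1%:R^-1.
have c0 n : 0 < c n by rewrite invr_gt0 ltr0n.
pose F n t := (c n)^-1 * (rnorm (e t + of_real (c n) *: h t) +
  rnorm (e t - of_real (c n) *: h t) - 2 * rnorm (e t)).
have F0 n t : 0 <= F n t.
  rewrite mulr_ge0 ?invr_ge0 ?(ltW (c0 n))//.
  by have /andP[] := rnorm_second_diff_bound (e t) (of_real (c n) *: h t).
have FP n := second_diff_integral e h (c n).
have [||||| _ _] := @dominated_convergence _ _ _ mu I mI (fun n t => (F n t)%:E)
    (cst 0%E) (fun t => (2 * rnorm (h t))%:E).
- by move=> n; have [/integrableP[]] := FP n.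
- exact: measurable_cst.
- apply: (@filterS _ _ (ae_filter_ringOfSetsType mu)) f0 => t /[apply] ft0.
  have rf0 : 0 < rnorm (f t).
    by rewrite lt_neqAle rnorm_ge0 andbT eq_sym;
       apply: contra ft0 => /eqP/rnorm_eq0/eqP.
  apply/cvg_EFin; first exact: nearW.
  (* Where f is nonzero, the quadratic bound divided by [c n] still carries a factor [c n]. *)
  apply: (@squeeze_cvgr _ _ _ _ (cst 0)
    (fun n => rnorm (h t) ^+ 2 / rnorm (f t) * c n)).
  + apply: nearW => n; rewrite F0/= /F ler_pdivrMl//.
    have := rnorm_second_diff_quadratic (of_real (c n) *: h t) rf0.
    (* The value [e t] is the norm of [f t], hence [of_real] of a positive real, as the quadratic
       bound requires. *)
    rewrite rnormE -[`|f t|]/(e t) eE rnorm_scale_real gtr0_norm//.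
    by move/le_trans; apply; rewrite le_eqVlt; apply/predU1P; left; ring.
  + exact: cvg_cst.
  + rewrite -[X in _ --> X](mulr0 (rnorm (h t) ^+ 2 / rnorm (f t))).
    by apply: cvgMr; exact: cvg_harmonic.
- exact: (integrableZl mI 2 (integrable_rnorm h)).
- apply: aeW => t n _; rewrite abse_EFin lee_fin ger0_norm//.
  rewrite /F ler_pdivrMl//.
  have /andP[_] := rnorm_second_diff_bound (e t) (of_real (c n) *: h t).
  by rewrite rnorm_scale_real gtr0_norm// mulrCA.
(* The integrals tend to 0, so some n brings them below d, and [c n] is the required t. *)
rewrite integral0 => /(_ [set y | (y < d%:E)%E]).
case=> [|n _ /(_ n (leqnn n))/=].
  by apply: open_nbhs_nbhs; split; [exact: open_ereal_lt_ereal|rewrite /= lte_fin].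
have [iF IF] := FP n.
rewrite -[X in (X < _)%E]fineK; last exact: integrable_fin_num.
rewrite lte_fin [X in X < _]IF e1 mulr1 => /ltW h1.
by exists (c n) => //; rewrite -ler_pdivrMr// mulrC.
Qed.

End absL1_smooth.

Theorem proposition3p7 (R : realType) (k : scalar_kind)
    (X : completeNormedModType (scalars R k)) (f : L1 X) :
  `|f| = 1 ->
  weakly_compact (state_space f) \/ compact (state_space f) ->
  smooth (absL1 f).
Proof.
elim/quotW: f => f f1 cf.
have {}f1 : rnorm (\pi_(L1 X)%qT f) = 1 by rewrite /rnorm f1 -of_real1 of_realK.
have {}cf : weakly_compact (state_space (\pi_(L1 X)%qT f)).
  by case: cf => //; exact: compact_weakly_compact.
apply: absL1_smooth => //; apply: contrapT => nf0.
(* Written through the real function [rnorm (f t)], the zero set inherits its measurability. *)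
pose Z := `[0, 1]%classic `&` (fun t => rnorm (f t)) @^-1` [set 0].
have Zf t : Z t -> f t = 0 by move=> [_ /rnorm_eq0].
have mZ : ((@wlength R idfun)^*)%mu.-cara.-measurable Z.
  apply: strongly_measurable_normr (bochnerP f).1 _ _ _ => //.
  - exact: completed_lebesgue_measure_is_complete.
  - exact: measurable_unit_itv.
  - exact: measurable_unit_itv.
(* Were [Z] null, it would witness that [f] is almost everywhere nonzero, against [nf0]. *)
have Z0 : (0 < @completed_lebesgue_measure R Z)%E.
  rewrite lt0e measure_ge0 andbT; apply/negP => /eqP Z0; apply: nf0.
  exists Z; split => // t /= nt.
  have [It ft] : `[0, 1]%classic t /\ f t = 0.
    by apply: contrapT => h; apply: nt => It; apply/eqP => ft; apply: h.
  by split => //=; rewrite ft rnorm0.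
(* A function of norm 1 has a nonzero value, which is normalised to give the unit vector. *)
have [x x1] : exists x : X, rnorm x = 1.
  have [t ft] : exists t, f t != 0.
    apply: contrapT => nft; have := oner_neq0 R; rewrite -f1 rnorm_L1 => /eqP; apply.
    rewrite /Rintegral integral0_eq// => t _; have [->|ft] := eqVneq (f t) 0.
      by rewrite rnorm0.
    by case: nft; exists t.
  have ft0 : rnorm (f t) != 0 by apply: contra ft => /eqP/rnorm_eq0/eqP.
  exists (of_real (rnorm (f t))^-1 *: f t).
  by rewrite rnorm_scale_real ger0_norm ?invr_ge0 ?rnorm_ge0// mulVf.
have ZI : Z `<=` `[0, 1]%classic by exact: subIsetl.
have [B [BZ mB BS B0]] := exists_shrinking_sets mZ ZI Z0.
exact: (zero_set_not_weakly_compact f1 x1 mZ ZI Zf BZ mB BS B0 cf).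
Qed.
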